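(* There exists a distribution of a random variable $W$ with values in $(0,1)$ satisfying $\mathrm{Var}(\log W)\in(0,\infty)$ and $\mathbb{E}|\log(1-W)|<\infty$ such that, with $\mu:=\mathbb{E}|\log W|$ and with $\rho_j(t)$ denoting the number of boxes of the $j$th generation of probability at least $1/t$ in the nested scheme generated by the stick-breaking probabilities $P_r=W_1W_2\cdots W_{r-1}(1-W_r)$, $r\in\mathbb{N}$ ($W_1,W_2,\ldots$ independent copies of $W$), the following holds for sequences $(j_n)_{n\in\mathbb{N}}$ of positive integers: the limit $$\lim_{n\to\infty}\frac{j_n^{1/2}(j_n-1)!\,\big|\mathbb{E}\rho_{j_n}(n)-(\log n)^{j_n}/(j_n!\,\mu^{j_n})\big|}{\mu^{-j_n}(\log n)^{j_n-1/2}}$$ exists and is finite and positive whenever $j_n\sim a(\log n)^{1/3}$ as $n\to\infty$ for some $a>0$, and it is equal to $+\infty$ whenever $\lim_{n\to\infty}(\log n)^{-1/3}j_n=\infty$ and $j_n=o((\log n)^{1/2})$ as $n\to\infty$.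
   Context: Let $\mathbb{V}=\bigcup_{k\ge 0}\mathbb{N}^k$ be the set of finite words over $\mathbb{N}=\{1,2,\ldots\}$; a word $v=v_1\ldots v_j$ has length (generation) $|v|=j$, and $\varnothing$ is the empty word. Let $((P_r(v))_{r\in\mathbb{N}})_{v\in\mathbb{V}}$ be a family of independent copies of $P=(P_r)_{r\in\mathbb{N}}$. Put $P(\varnothing)=1$ and $P(vr)=P(v)P_r(v)$ for $v\in\mathbb{V}$, $r\in\mathbb{N}$. Words are identified with boxes and $P(v)$ is the probability of the box $v$. For $j\in\mathbb{N}$ and $t>0$, $\rho_j(t):=\#\{v\in\mathbb{V}:|v|=j,\ P(v)\ge 1/t\}$. *)

(* Defs.v *)
From HB Require Import structures.
From mathcomp Require Import all_boot all_order all_algebra.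
From mathcomp Require Import all_classical all_reals all_analysis.

Set Implicit Arguments.
Unset Strict Implicit.
Unset Printing Implicit Defensive.

Import Order.TTheory GRing.Theory Num.Theory.
Import numFieldNormedType.Exports.

Local Open Scope classical_set_scope.
Local Open Scope ring_scope.

(** Positive integers [1, 2, ...] that serve as indices or letters are encoded
    by [nat], shifted by one: [r : nat] stands for the index [r + 1].  Words
    are then elements of [seq nat], and the word [vr] is [rcons v r]. *)

Section Independence.
Local Open Scope ereal_scope.

Definition iid_with_law (R : realType) (L : probability R R)
    (d : measure_display) (T : measurableType d) (P : probability T R)
    (W : nat -> {RV P >-> R}) : Prop :=
  (forall i (B : set R), measurable B -> distribution P (W i) B = L B) /\
  (forall (s : seq nat) (B : nat -> set R), uniq s ->
     (forall i, measurable (B i)) ->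
     P (\bigcap_(i in [set` s]) (W i @^-1` B i)) =
     \prod_(i <- s) P (W i @^-1` B i)).

(** The product sigma-algebra on real sequences. *)
Definition seq_sigma_algebra (R : realType) : set (set (nat -> R)) :=
  <<s [set A | exists r (B : set R),
         measurable B /\ A = (fun x : nat -> R => x r) @^-1` B] >>.

(** The random sequences [p v], [v] a word, are independent, and each one has
    the law of the random sequence [X], possibly defined on another space. *)
Definition independent_copies (R : realType)
    (d0 : measure_display) (T0 : measurableType d0) (P0 : probability T0 R)
    (X : nat -> T0 -> R)
    (d : measure_display) (T : measurableType d) (P : probability T R)
    (p : seq nat -> nat -> {RV P >-> R}) : Prop :=
  (forall v (A : set (nat -> R)), seq_sigma_algebra A ->
     P [set w | A (fun r => p v r w)] = P0 [set w | A (fun r => X r w)]) /\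
  (forall (s : seq (seq nat)) (A : seq nat -> set (nat -> R)), uniq s ->
     (forall v, seq_sigma_algebra (A v)) ->
     P (\bigcap_(v in [set` s]) [set w | A v (fun r => p v r w)]) =
     \prod_(v <- s) P [set w | A v (fun r => p v r w)]).

End Independence.

Definition stick_breaking (R : realType) (T : Type) (W : nat -> T -> R)
    (r : nat) (w : T) : R :=
  (\prod_(i < r) W i w) * (1 - W r w).

Section NestedScheme.
Variables (R : realType) (T : Type) (p : seq nat -> nat -> T -> R).

(** [box_prob v] is the product of [p u r] over the prefixes [ur] of [v]; the
    defining recursion is given by [box_prob_nil] and [box_prob_rcons]. *)
Definition box_prob (v : seq nat) (w : T) : R :=
  \prod_(i < size v) p (take i v) (nth 0%N v i) w.

Lemma box_prob_nil w : box_prob [::] w = 1.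
Proof. by rewrite /box_prob big_ord0. Qed.

Lemma box_prob_rcons v r w : box_prob (rcons v r) w = box_prob v w * p v r w.
Proof.
rewrite /box_prob size_rcons big_ord_recr /=; congr (_ * _).
  apply: eq_bigr => i _; rewrite nth_rcons ltn_ord -cats1 takel_cat //.
  exact/ltnW.
by rewrite nth_rcons ltnn eqxx -cats1 takel_cat // take_size.
Qed.

(** Valued in the extended reals, since the number of boxes may be infinite on
    a negligible event. *)
Definition box_count (j : nat) (t : R) (w : T) : \bar R :=
  counting [set v : seq nat | size v = j /\ t^-1 <= box_prob v w].

End NestedScheme.

Definition mean_box_count (R : realType) (d : measure_display)
    (T : measurableType d) (P : probability T R)
    (p : seq nat -> nat -> {RV P >-> R}) (j : nat) (t : R) : \bar R :=
  (\int[P]_w box_count p j t w)%E.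

(** [m k t] stands for the expected number of boxes of generation [k] of
    probability at least [1/t]. *)
Definition normalized_error (R : realType) (mu : R) (m : nat -> R -> \bar R)
    (j : nat -> nat) (n : nat) : \bar R :=
  let k := j n in
  let L : R := ln n%:R in
  ((Num.sqrt k%:R * (k.-1)`!%:R)%:E
     * `| m k n%:R - (L ^+ k / (k`!%:R * mu ^+ k))%:E |
     * ((mu ^- k * L `^ (k%:R - 2^-1))^-1)%:E)%E.

(* Main.v *)
(** Let [W] have density [2w] on [(0, 1)]. Then [|log W|] is exponential with
    parameter 2, [mu = 1/2], and the intensity measure of [-log P_r], [r >= 1],
    has the density [2 (1 - e^-x)] on [x > 0], that is, twice the convolution of
    the Lebesgue measure with the standard exponential law. Its [j]-fold
    convolution power gives
    [E rho_j(t) = 2^j / j! * E (log t - G_j)_+^j]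
    with [G_j] a sum of [j] standard exponentials. As [E G_j = j], the error is
    [2^j j / (j-1)! * (log t)^(j-1) * (1 + O(j^2 / log t))], and the normalized
    error is [j^(3/2) (log n)^(-1/2) (1 + O(j^2 / log n))].

    The functions [c k m = E (log t - G_m)_+^k / k!] are built from powers of
    [log t] by the recursion [c k (m+1) = c k m - c (k-1) (m+1)], which also yields
    the two-sided bounds. That averaging over the boxes of a generation maps
    [c k m] to [2 c (k+1) (m+1)] follows from the one-step identity
    [g(u) = E (f (u (1 - W)) + g (u W))] for [f = c k m], [g = 2 c (k+1) (m+1)]. *)

Require Import Defs.
From mathcomp Require Import all_boot all_order all_algebra.
From mathcomp Require Import all_classical all_reals all_analysis.
From mathcomp Require Import measurable_realfun.
From mathcomp Require Import ring lra.

Set Implicit Arguments.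
Unset Strict Implicit.
Unset Printing Implicit Defensive.

Import Order.TTheory GRing.Theory Num.Theory.
Import numFieldNormedType.Exports.

Local Open Scope classical_set_scope.
Local Open Scope ring_scope.

(** * Powers of the logarithm, the functions [boxfun], and their two-sided bounds *)

Section LogPowers.
Variable R : realType.
Implicit Types (u v s : R) (k m : nat).

Definition lnpow k u : R := ln u ^+ k / k`!%:R.

Lemma is_derive_mulr (f g : R -> R) u df dg : is_derive u 1 f df ->
  is_derive u 1 g dg ->
  is_derive u 1 (fun y => f y * g y) (df * g u + f u * dg).
Proof.
move=> df' dg'; have /is_derive_eq := is_deriveM df' dg'; apply.
by rewrite /GRing.scale /= addrC [g u * _]mulrC.
Qed.

Lemma is_derive_divr (f : R -> R) u df : u != 0 -> is_derive u 1 f df ->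
  is_derive u 1 (fun y => f y / y) (df / u - f u / u ^+ 2).
Proof.
move=> u0 df'; have dV := is_deriveV u0 (is_derive_id u (1 : R)).
have /is_derive_eq := is_derive_mulr df' dV; apply.
by rewrite /GRing.scale /= mulr1 mulrN.
Qed.

Lemma lnpow_ge0 k u : 1 <= u -> 0 <= lnpow k u.
Proof. by move=> u1; rewrite divr_ge0// exprn_ge0// ln_ge0. Qed.

Lemma lnpow_le k u : 1 <= u -> lnpow k u <= u.
Proof.
move=> u1; have l0 : 0 <= ln u by exact: ln_ge0.
have u0 : 0 < u by exact: lt_le_trans u1.
case: k => [|k]; first by rewrite /lnpow expr0 fact0 divr1.
have := expR_ge1Dxn k l0; rewrite lnK ?posrE// -/(lnpow _ _) => h.
by rewrite (le_trans _ h)// lerDr.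
Qed.

Lemma is_derive_lnpow k u : 0 < u ->
  is_derive u 1 (lnpow k.+1) (lnpow k u / u).
Proof.
move=> u0; have du := is_derive1_ln u0.
have := is_derive_mulr (is_deriveX k.+1 du)
  (is_derive_cst (k.+1`!%:R^-1 : R) u 1).
rewrite (_ : (fun y => _) = lnpow k.+1); last first.
  by apply/funext => y; rewrite exprfctE.
move=> /is_derive_eq; apply; rewrite /cst /= /lnpow factS natrM invfM.
rewrite /GRing.scale /=; field.
by rewrite nat1r !pnatr_eq0 -!lt0n fact_gt0 gt_eqF.
Qed.

(* For [u >= 1], [boxfun m k.+1 u] is the expectation of [(ln u - G)_+ ^ k / k!]
   with [G] a sum of [m] independent standard exponential variables; [boxfun m 0]
   is chosen so that [u * (boxfun m k.+1)' = boxfun m k] holds for [k = 0] too. *)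
Fixpoint boxfun m k u : R :=
  match m with
  | 0 => if k is k'.+1 then lnpow k' u else 0
  | m'.+1 =>
    (fix bf k := if k is k'.+1 then boxfun m' k u - bf k' else lnpow m' u / u) k
  end.

Lemma boxfunS m k u :
  boxfun m.+1 k.+1 u = boxfun m k.+1 u - boxfun m.+1 k u.
Proof. by []. Qed.

(** In the variable [x = ln u] this is the equation [f' = g - f], which for [k > 0] links [g] to its
    average [f] over a shift by a standard exponential variable. The double induction follows the
    recursion of [boxfun], with [lnpow m u / u] differentiated directly at [k = 0]. *)
Lemma is_derive_boxfunS m k u : 0 < u ->
  is_derive u 1 (boxfun m.+1 k) ((boxfun m k u - boxfun m.+1 k u) / u).
Proof.
move=> u0; have un0 : u != 0 by rewrite gt_eqF.
elim: m k => [|m IHm]; elim=> [|k IHk].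
- have := is_derive_divr un0 (is_derive_cst (lnpow 0 u) u 1).
  have -> : (fun y => cst (lnpow 0 u) y / y) = boxfun 1 0.
    by apply/funext => y; rewrite /lnpow !expr0.
  by move=> /is_derive_eq; apply; rewrite /= /cst; field.
- have d : is_derive u 1 (boxfun 0 k.+1) (boxfun 0 k u / u).
    case: k {IHk} => [|k]; last exact: is_derive_lnpow.
    rewrite /= mul0r; have := is_derive_cst (1 : R) u (1 : R).
    by congr is_derive; apply/funext => y; rewrite /= /lnpow expr0 fact0 divr1.
  have := is_deriveB d IHk; move=> /is_derive_eq; apply.
  by rewrite boxfunS -mulrBl; congr (_ / _); ring.
- have /is_derive_eq := is_derive_divr un0 (is_derive_lnpow m u0).
  by apply; rewrite /=; field.
- have := is_deriveB (IHm k.+1) IHk; move=> /is_derive_eq; apply.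
  by rewrite !boxfunS -mulrBl; congr (_ / _); ring.
Qed.

(** For [m > 0], [boxfunS] collapses the numerator in [is_derive_boxfunS] to a single term. *)
Lemma is_derive_boxfun m k u : 0 < u ->
  is_derive u 1 (boxfun m k.+1) (boxfun m k u / u).
Proof.
move=> u0; case: m => [|m]; last first.
  have := is_derive_boxfunS m k.+1 u0.
  by move=> /is_derive_eq; apply; rewrite boxfunS opprB addrCA subrr addr0.
case: k => [|k]; last exact: is_derive_lnpow.
rewrite /= mul0r; have := is_derive_cst (1 : R) u (1 : R).
by congr is_derive; apply/funext => y; rewrite /= /lnpow expr0 fact0 divr1.
Qed.

(** The factor [y], which is [e^x] for [x = ln y], is the integrating factor of the equation in
    [is_derive_boxfunS]. This supplies a primitive of [boxfun m k]. *)
Lemma is_derive_mul_boxfun m k u : 0 < u ->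
  is_derive u 1 (fun y => y * boxfun m.+1 k y) (boxfun m k u).
Proof.
move=> u0; have := is_derive_mulr (is_derive_id u 1) (is_derive_boxfunS m k u0).
by move=> /is_derive_eq; apply; field; rewrite gt_eqF.
Qed.

Lemma continuous_boxfun m k u : 0 < u -> {for u, continuous (boxfun m k.+1)}.
Proof.
move=> u0; apply/differentiable_continuous/derivable1_diffP.
by have [] := is_derive_boxfun m k u0.
Qed.

(** Here [ln u = 0]: the power of the positive part is 0 for [k > 0], and for [k = 0] it is the
    indicator of [G <= 0], a null event unless [m = 0]. *)
Lemma boxfun_at1 m k : boxfun m k.+1 1 = ((m == 0) && (k == 0))%:R.
Proof.
have l k' : lnpow k' 1 = (k' == 0)%:R.
  by rewrite /lnpow ln1 expr0n; case: k' => [|k']; rewrite ?fact0 ?divr1 ?mul0r.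
elim: m k => [|m IHm] k; first by rewrite /= l.
elim: k => [|k IHk]; last by rewrite boxfunS IHk IHm andbF subr0.
by rewrite boxfunS IHm /= divr1 l andbT subrr.
Qed.

(** Induction on [k]: by [is_derive_boxfun] the next function is nondecreasing on [[1, +oo[], and it
    starts from the nonnegative value given by [boxfun_at1]. *)
Lemma boxfun_ge0 m k u : 1 <= u -> 0 <= boxfun m k u.
Proof.
move=> u1; elim: k => [|k IHk] in u u1 *.
  by case: m => //= m; rewrite divr_ge0 ?lnpow_ge0// (le_trans _ u1).
have pos v : v \in `]1, +oo[ -> 0 < v.
  by rewrite in_itv /= andbT => /(lt_trans _); apply.
have : boxfun m k.+1 1 <= boxfun m k.+1 u.
  apply: (@ger0_derive1_ndecry R (boxfun m k.+1) 1) => //.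
  - by move=> v /pos v0; have [] := is_derive_boxfun m k v0.
  - move=> v v1; have v0 := pos _ v1; rewrite derive1E.
    have := is_derive_boxfun m k v0 => -[_ ->].
    rewrite divr_ge0 ?(ltW v0)// IHk//.
    by move: v1; rewrite in_itv /= andbT => /ltW.
  - apply: continuous_in_subspaceT => v; rewrite inE /= in_itv /= andbT => v1.
    by apply: continuous_boxfun; rewrite (lt_le_trans _ v1).
by apply: le_trans; rewrite boxfun_at1 ler0n.
Qed.

Lemma boxfun_le_lnpow m k u : 1 <= u -> boxfun m k.+1 u <= lnpow k u.
Proof.
move=> u1; elim: m => [//|m IHm]; rewrite boxfunS.
by rewrite (le_trans _ IHm)// gerBl boxfun_ge0.
Qed.

Lemma boxfun_le m k u : 1 <= u -> boxfun m k.+1 u <= u.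
Proof.
by move=> u1; rewrite (le_trans (boxfun_le_lnpow _ _ u1))// lnpow_le.
Qed.

(** Each of the [m] steps of the recursion subtracts at most [lnpow k u], by [boxfun_le_lnpow]. *)
Lemma boxfun_lower m k u : 1 <= u ->
  lnpow k.+1 u - m%:R * lnpow k u <= boxfun m k.+2 u.
Proof.
move=> u1; elim: m => [|m IHm]; first by rewrite mul0r subr0.
rewrite boxfunS -natr1 mulrDl mul1r opprD addrA lerB//.
exact: boxfun_le_lnpow.
Qed.

(** By [boxfun_lower], the step from [m] to [m.+1] subtracts at least
    [lnpow k.+1 u - m.+1%:R * lnpow k u]; the coefficients [1 + ... + m] add up to
    [m (m + 1) / 2]. *)
Lemma boxfun_upper m k u : 1 <= u ->
  boxfun m k.+3 u <=
  lnpow k.+2 u - m%:R * lnpow k.+1 u + (m * m.+1)%:R / 2 * lnpow k u.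
Proof.
move=> u1; elim: m => [|m IHm]; first by rewrite !mul0r subr0 addr0.
rewrite boxfunS (le_trans (lerB IHm (boxfun_lower m.+1 k u1)))//.
rewrite le_eqVlt; apply/orP; left; apply/eqP.
by rewrite !natrM -!natr1; field.
Qed.

End LogPowers.


(** * The law with density [2 x] on [[0, 1]] *)

Section BetaTwoOne.
Variable R : realType.
Local Notation mu := (@lebesgue_measure R).

Let id_measurable :
  @measurable_fun _ default_measure_display (measurableTypeR R) R setT idfun.
Proof. by move=> _ A mA; rewrite setTI. Qed.

(* [beta_prob] is a measure on the measurable space [measurableTypeR R]; it is
   transported to [R] by the identity. *)
Definition beta21 : probability R R :=
  @distribution _ _ (measurableTypeR R) R R (@beta_prob R 2 1)
    (@mfun_Sub _ default_measure_display (measurableTypeR R) R idfun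
      (mem_set id_measurable)).

Lemma beta21_pdfE (x : R) : `[0, 1]%classic x -> beta_pdf 2 1 x = 2 * x.
Proof.
move=> x01; rewrite /beta_pdf patchE mem_set//= beta_fun_sym beta_fun1Sn.
by rewrite /XMonemX expr1 expr0 mulr1 invrK mulrC.
Qed.

(** The Radon-Nikodym derivative of [beta_prob] agrees almost everywhere with [beta_pdf], since both
    have the same integral over every measurable set. *)
Lemma ge0_integral_beta21 (f : R -> \bar R) : measurable_fun setT f ->
  (forall x, (0 <= f x)%E) ->
  (\int[beta21]_x f x = \int[mu]_(x in `[0%R, 1%R]) (f x * (2 * x)%:E))%E.
Proof.
move=> mf f0; rewrite ge0_integral_distribution//=.
have Lmu := @beta_prob_dom R 2 1.
rewrite -(Radon_Nikodym_SigmaFinite.change_of_variables Lmu f0)//.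
have mpdf : measurable_fun setT (EFin \o @beta_pdf R 2 1).
  by apply/measurable_EFinP; exact: measurable_beta_pdf.
have int_f := @Radon_Nikodym_SigmaFinite.f_integrable _ _ _ (@beta_prob R 2 1) mu Lmu.
transitivity (\int[mu]_x (f x * (beta_pdf 2 1 x)%:E))%E.
  apply: ae_eq_integral => //.
  - by apply: emeasurable_funM => //; exact: measurable_int int_f.
  - exact: emeasurable_funM.
  - apply: ae_eqe_mul2l; apply: integral_ae_eq => //.
    move=> A _ mA; rewrite integral_beta_pdf//.
    by rewrite -Radon_Nikodym_SigmaFinite.f_integral.
rewrite [RHS]integral_mkcond; apply: eq_integral => x _; rewrite patchE.
case: ifPn => [|x01]; first by rewrite inE => /beta21_pdfE ->.
by rewrite /beta_pdf patchE (negbTE x01) mul0r mule0.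
Qed.

End BetaTwoOne.

(** * The one-step identity for the truncated functions *)

Section BoxIntegral.
Variable R : realType.
Implicit Types (v u w : R) (k m : nat).
Local Notation mu := (@lebesgue_measure R).
Local Notation L := (@beta21 R).

(** This is [c k m] at [t = u], with the index shift of [boxfun] undone. Below 1 the positive part
    vanishes; in particular [tboxfun 0 0] is the indicator of [[1, +oo[]. *)
Definition tboxfun m k u : R := if 1 <= u then boxfun m k.+1 u else 0.

Lemma tboxfun_ge0 m k u : 0 <= tboxfun m k u.
Proof. by rewrite /tboxfun; case: ifPn => // /boxfun_ge0. Qed.

Lemma tboxfun_le m k u : 0 <= u -> tboxfun m k u <= u.
Proof. by rewrite /tboxfun; case: ifPn => // /boxfun_le. Qed.

Lemma measurable_tboxfun m k : measurable_fun setT (tboxfun m k).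
Proof.
rewrite (_ : tboxfun m k = boxfun m k.+1 \_ `[1, +oo[); last first.
  apply/funext => u; rewrite patchE /tboxfun.
  have -> : (u \in `[1, +oo[%classic) = (1 <= u).
    by rewrite mem_setE; exact: andbT.
  by case: ifPn.
apply: (measurable_restrictT (boxfun m k.+1) (measurable_itv _)).1.
apply: subspace_continuous_measurable_fun => //.
apply: continuous_in_subspaceT => v; rewrite inE /= in_itv /= andbT => v1.
by apply: continuous_boxfun; rewrite (lt_le_trans _ v1).
Qed.

Lemma is_derive_comp_scale (f : R -> R) v w df : is_derive (v * w) 1 f df ->
  is_derive w 1 (fun y => f (v * y)) (df * v).
Proof.
move=> df'; apply: (is_derive1_comp df').
have := is_derive_mulr (is_derive_cst v w (1 : R)) (is_derive_id w (1 : R)).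
by move=> /is_derive_eq; apply; rewrite /cst /= mul0r add0r mulr1.
Qed.

Lemma integral_boxfun m k v : 1 <= v ->
  (\int[mu]_(w in `[v^-1%R, 1%R]) (2 * (1 - w) * boxfun m k.+1 (v * w) +
     4 * w * boxfun m.+1 k.+2 (v * w))%:E = (2 * boxfun m.+1 k.+2 v)%:E)%E.
Proof.
rewrite le_eqVlt => /predU1P[<-|v1].
  by rewrite invr1 set_itv1 integral_set1 boxfun_at1 mulr0.
have v0 : 0 < v by exact: lt_trans v1.
have vV1 : v^-1 < 1 by rewrite invf_lt1.
have vV0 : 0 < v^-1 by rewrite invr_gt0.
have vn0 : v != 0 by rewrite gt_eqF.
(* A primitive of the integrand: differentiating [1 - w] in the first term leaves
   [- 2 * w * boxfun m.+1 k.+1 (v * w)], which the derivative of [boxfun m.+1 k.+2] in the second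
   term cancels. By [boxfun_at1], [Psi] vanishes at [v^-1]. *)
pose Psi w := 2 * (w * boxfun m.+1 k.+1 (v * w)) * (1 - w) +
              2 * w * w * boxfun m.+1 k.+2 (v * w).
have cB m' k' w : 0 < w -> {for w, continuous (fun w => boxfun m' k'.+1 (v * w))}.
  move=> w0; have vw0 : 0 < v * w by rewrite mulr_gt0.
  have := is_derive_comp_scale (is_derive_boxfun m' k' vw0).
  by move=> [? _]; apply/differentiable_continuous/derivable1_diffP.
have dPsi w : 0 < w -> is_derive w 1 Psi (2 * (1 - w) * boxfun m k.+1 (v * w) +
     4 * w * boxfun m.+1 k.+2 (v * w)).
  move=> w0; have vw0 : 0 < v * w by rewrite mulr_gt0.
  have dh : is_derive w 1 (fun w => w * boxfun m.+1 k.+1 (v * w))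
      (boxfun m k.+1 (v * w)).
    have := is_derive_mulr (is_derive_cst v^-1 w 1)
      (is_derive_comp_scale (is_derive_mul_boxfun m k.+1 vw0)).
    rewrite (_ : (fun y => _) = fun w => w * boxfun m.+1 k.+1 (v * w)).
      by move=> /is_derive_eq; apply; rewrite /cst; field.
    by apply/funext => y; rewrite /cst; field.
  have dg := is_derive_comp_scale (is_derive_boxfun m.+1 k.+1 vw0).
  have d2 := is_derive_cst (2 : R) w (1 : R).
  have d1 := is_deriveB (is_derive_cst (1 : R) w (1 : R)) (is_derive_id w (1 : R)).
  have did := is_derive_id w (1 : R).
  have := is_deriveD (is_derive_mulr (is_derive_mulr d2 dh) d1)
    (is_derive_mulr (is_derive_mulr (is_derive_mulr d2 did) did) dg).
  move=> /is_derive_eq; apply; rewrite /cst /=.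
  rewrite [(cst 1 - id) w](_ : _ = 1 - w)//; field.
  by rewrite vn0 gt_eqF.
have cF w : 0 < w -> {for w, continuous (fun w => 2 * (1 - w) *
    boxfun m k.+1 (v * w) + 4 * w * boxfun m.+1 k.+2 (v * w) : R)}.
  move=> w0; apply: continuousD; apply: continuousM; try exact: cB.
    apply: continuousM; first exact: cvg_cst.
    by apply: continuousB; [exact: cvg_cst|exact: cvg_id].
  by apply: continuousM; [exact: cvg_cst|exact: cvg_id].
have in_pos w : w \in `[v^-1, 1] -> 0 < w.
  by rewrite in_itv /= => /andP[/(lt_le_trans vV0)].
have cPsi w : 0 < w -> {for w, continuous Psi}.
  move=> w0; apply/differentiable_continuous/derivable1_diffP.
  by have [] := dPsi w w0.
rewrite (@continuous_FTC2 R _ Psi)//.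
- rewrite -EFinB; congr EFin; rewrite /Psi mulr1 divff// boxfun_at1.
  by rewrite boxfun_at1 andbF /= mulr0; ring.
- by apply: continuous_in_subspaceT => w; rewrite inE /= => /in_pos; exact: cF.
- split.
  + move=> w /subset_itv_oo_cc/in_pos w0; by have [] := dPsi w w0.
  + exact/cvg_at_right_filter/cPsi.
  + exact/cvg_at_left_filter/cPsi.
- move=> w /subset_itv_oo_cc/in_pos w0; rewrite derive1E.
  by have [_ ->] := dPsi w w0.
Qed.

(* The change of variables [w -> 1 - w] in the first summand gives an integral
   over [[1/v, 1]] whose integrand has an explicit primitive. *)
Lemma expectation_tboxfun m k v :
  (\int[L]_w (tboxfun m k (v * (1 - w)) + 2 * tboxfun m.+1 k.+1 (v * w))%:E =
   (2 * tboxfun m.+1 k.+1 v)%:E)%E.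
Proof.
rewrite ge0_integral_beta21; last 2 first.
- apply/measurable_EFinP; apply: measurable_funD.
    apply: (measurableT_comp (measurable_tboxfun _ _)) => //.
    by apply: measurable_funM => //; exact: measurable_funB.
  apply: measurable_funM => //.
  by apply: (measurableT_comp (measurable_tboxfun _ _)); exact: measurable_funM.
- by move=> w; rewrite lee_fin addr_ge0 ?mulr_ge0// tboxfun_ge0.
(* For [v < 1], possibly negative, the arguments [v * (1 - w)] and [v * w] stay below 1, so
   everything is truncated to 0. *)
have [v1|v1] := leP 1 v; last first.
  rewrite /tboxfun leNgt v1 /= mulr0 integral0_eq// => w /=.
  rewrite in_itv /= => /andP[w0 w1].
  have lt1 x : 0 <= x -> x <= 1 -> v * x < 1.
    move=> x0 x1; have [v0|v0] := leP 0 v.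
      by rewrite (le_lt_trans _ v1)// ler_piMr.
    by rewrite (le_lt_trans _ ltr01)// mulr_le0_ge0// ltW.
  rewrite !leNgt !lt1 ?subr_ge0//= ?gerBl//.
  by rewrite mulr0 addr0 mul0e.
have v0 : 0 < v by exact: lt_le_trans v1.
have vn0 : v != 0 by rewrite gt_eqF.
have vV0 : 0 < v^-1 by rewrite invr_gt0.
have vV1 : v^-1 <= 1 by rewrite invf_le1.
have mtb (f : R -> R) m' k' : measurable_fun setT f ->
    measurable_fun setT (fun w => tboxfun m' k' (f w)).
  by move=> mf; exact: (measurableT_comp (measurable_tboxfun _ _)).
(* [A] and [B] are the two summands multiplied by the density [2 * w], without truncation. *)
pose A w := 2 * w * boxfun m k.+1 (v * (1 - w)).
pose B w := 4 * w * boxfun m.+1 k.+2 (v * w).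
have cA : {within `[0, 1 - v^-1], continuous A}.
  apply: continuous_in_subspaceT => w; rewrite inE /= in_itv /= => /andP[w0 w1].
  have vw0 : 0 < v * (1 - w) by rewrite mulr_gt0// subr_gt0 (le_lt_trans w1)// gtrBl.
  apply: continuousM; first by apply: continuousM; [exact: cvg_cst|exact: cvg_id].
  apply: (@continuous_comp _ _ _ (fun w => v * (1 - w))); last exact: continuous_boxfun.
  by apply: continuousM; [exact: cvg_cst|apply: continuousB; [exact: cvg_cst|exact: cvg_id]].
transitivity (\int[mu]_(w in `[0%R, 1%R])
   ((tboxfun m k (v * (1 - w)) * (2 * w))%:E +
    (2 * tboxfun m.+1 k.+1 (v * w) * (2 * w))%:E))%E.
  by apply: eq_integral => w _; rewrite -EFinM -EFinD mulrDl.
rewrite ge0_integralD//=; last 4 first.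
- move=> w; rewrite in_itv /= => /andP[w0 _].
  by rewrite lee_fin mulr_ge0 ?tboxfun_ge0// mulr_ge0.
- apply/measurable_EFinP/measurable_funTS; apply: measurable_funM.
    by apply: mtb; apply: measurable_funM => //; exact: measurable_funB.
  exact: measurable_funM.
- move=> w; rewrite in_itv /= => /andP[w0 _].
  by rewrite lee_fin !mulr_ge0 ?tboxfun_ge0.
- apply/measurable_EFinP/measurable_funTS; apply: measurable_funM.
    by apply: measurable_funM => //; apply: mtb; exact: measurable_funM.
  exact: measurable_funM.
(* The truncation amounts to a restriction of the domain: [1 <= v * (1 - w)] means [w <= 1 - v^-1],
   and [1 <= v * w] means [v^-1 <= w]. *)
transitivity (\int[mu]_(w in `[0%R, (1 - v^-1)%R]) (A w)%:E +
  \int[mu]_(w in `[v^-1%R, 1%R]) (B w)%:E)%E.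
  congr (_ + _)%E.
    rewrite (_ : `[0, 1 - v^-1]%classic = `[0, 1] `&` `[0, 1 - v^-1]); last first.
      rewrite setIidr// => w /=; rewrite !in_itv /= => /andP[-> w1] /=.
      by rewrite (le_trans w1)// gerBl ltW.
    rewrite integral_mkcondr; apply: eq_integral => w; rewrite inE /= in_itv /=.
    move=> /andP[w0 w1]; rewrite patchE.
    have -> : (w \in `[0, 1 - v^-1]%classic) = (w <= 1 - v^-1).
      by rewrite mem_setE; exact: (andb_idl (fun _ => w0)).
    rewrite /tboxfun -[1 <= _]ler_pdivrMl// mulr1 !lerBrDr [v^-1 + w]addrC.
    by case: ifPn => _; rewrite ?mul0r// /A mulrC.
  rewrite (_ : `[v^-1, 1]%classic = `[0, 1] `&` `[v^-1, 1]); last first.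
    rewrite setIidr// => w /=; rewrite !in_itv /= => /andP[w1 ->].
    by rewrite (le_trans _ w1)// ltW.
  rewrite integral_mkcondr; apply: eq_integral => w; rewrite inE /= in_itv /=.
  move=> /andP[w0 w1]; rewrite patchE.
  have -> : (w \in `[v^-1, 1]%classic) = (v^-1 <= w).
    by rewrite mem_setE; exact: (andb_idr (fun _ => w1)).
  rewrite /tboxfun -[1 <= _]ler_pdivrMl// mulr1.
  by case: ifPn => _; rewrite ?mulr0 ?mul0r// /B; congr EFin; ring.
rewrite integration_by_substitution_onem//; last first.
  by rewrite subr_ge0 vV1 gerBl ltW.
rewrite /tboxfun v1 -integral_boxfun// /unstable.onem subKr.
have ge_v1 w : `[v^-1, 1]%classic w -> 1 <= v * w.
  by rewrite /= in_itv /= => /andP[+ _]; rewrite -ler_pdivrMl// mulr1.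
have cAw w : 1 <= v * w -> {for w, continuous (fun w => A (1 - w))}.
  move=> vw1; have vw0 : 0 < v * w by exact: lt_le_trans vw1.
  rewrite /A; apply: continuousM.
    apply: continuousM; first exact: cvg_cst.
    by apply: continuousB; [exact: cvg_cst|exact: cvg_id].
  apply: (@continuous_comp _ _ _ (fun w => v * (1 - (1 - w)))); last first.
    by rewrite subKr; exact: continuous_boxfun.
  apply: continuousM; first exact: cvg_cst.
  apply: continuousB; first exact: cvg_cst.
  by apply: continuousB; [exact: cvg_cst|exact: cvg_id].
have cBw w : 1 <= v * w -> {for w, continuous B}.
  move=> vw1; have vw0 : 0 < v * w by exact: lt_le_trans vw1.
  apply: continuousM.
    by apply: continuousM; [exact: cvg_cst|exact: cvg_id].
  apply: (@continuous_comp _ _ _ (fun w => v * w)); last exact: continuous_boxfun.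
  by apply: continuousM; [exact: cvg_cst|exact: cvg_id].
rewrite -ge0_integralD//=.
- apply: eq_integral => w _; rewrite -EFinD; congr EFin.
  by rewrite /A /B subKr.
- move=> w ww; have := ge_v1 w ww; move: ww; rewrite /= in_itv /= => /andP[_ w1] vw1.
  by rewrite lee_fin /A !mulr_ge0 ?subr_ge0// subKr boxfun_ge0.
- apply/measurable_EFinP; apply: subspace_continuous_measurable_fun => //.
  apply: continuous_in_subspaceT => w; rewrite inE => ww.
  exact/cAw/ge_v1.
- move=> w ww; have := ge_v1 w ww; move: ww; rewrite /= in_itv /= => /andP[w0 _] vw1.
  by rewrite lee_fin /B !mulr_ge0 ?boxfun_ge0// (le_trans _ w0)// ltW.
- apply/measurable_EFinP; apply: subspace_continuous_measurable_fun => //.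
  apply: continuous_in_subspaceT => w; rewrite inE => ww.
  exact/cBw/ge_v1.
Qed.

End BoxIntegral.

(** * Independence of a product of independent factors from the next factor *)

Section IndependentProducts.
Variables (R : realType) (d : measure_display) (T : measurableType d).
Variable P : probability T R.
Local Open Scope ereal_scope.

(** Factorization on rectangles identifies the joint law with the product of the marginal laws; the
    rest is Tonelli. *)
Lemma independent_integral (X Y : T -> R) (f : R * R -> \bar R) :
  measurable_fun setT X -> measurable_fun setT Y ->
  (forall A B, measurable A -> measurable B ->
    P (X @^-1` A `&` Y @^-1` B) = P (X @^-1` A) * P (Y @^-1` B)) ->
  measurable_fun setT f -> (forall z, 0 <= f z) ->
  \int[P]_w f (X w, Y w) = \int[P]_w \int[P]_w' f (X w, Y w').
Proof.
move=> mX mY XY mf f0.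
pose X' : {RV P >-> R} := mfun_Sub (mem_set mX).
pose Y' : {RV P >-> R} := mfun_Sub (mem_set mY).
pose Z' : {RV P >-> (R * R)%type} :=
  mfun_Sub (mem_set (measurable_fun_pair mX mY)).
transitivity (\int[distribution P Z']_z f z).
  by rewrite ge0_integral_distribution.
transitivity (\int[distribution P X' \x distribution P Y']_z f z).
  apply: eq_measure_integral => D mD _.
  by apply/esym; apply: product_measure_unique => // A B mA mB; exact: XY.
rewrite fubini_tonelli1// ge0_integral_distribution//.
- apply: eq_integral => w _ /=; rewrite /fubini_F ge0_integral_distribution//.
  exact: measurable_fun_pair2.
- exact: measurable_fun_fubini_tonelli_F.
- by move=> x; exact: integral_ge0.
Qed.

(** As functions of [D] both sides are finite measures on the plane: the law of the pair restricted
    to [C], and the law of the pair scaled by [P C]. They agree on the rectangles, which are stable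
    under intersection and generate. *)
Lemma independent_pair_event (X Y : T -> R) (C : set T) :
  measurable_fun setT X -> measurable_fun setT Y -> measurable C ->
  (forall A B, measurable A -> measurable B ->
    P (X @^-1` A `&` Y @^-1` B `&` C) = P (X @^-1` A `&` Y @^-1` B) * P C) ->
  forall D, measurable D ->
    P ((fun w => (X w, Y w)) @^-1` D `&` C) =
    P ((fun w => (X w, Y w)) @^-1` D) * P C.
Proof.
move=> mX mY mC XYC D mD.
pose Z : {RV P >-> (R * R)%type} :=
  mfun_Sub (mem_set (measurable_fun_pair mX mY)).
have PC0 : (0 <= fine (P C))%R by exact: fine_ge0.
have mZ : measurable_fun setT Z by [].
have [m1 m1E] : exists m : {measure set (R * R)%type -> \bar R},
    forall E, m E = P (Z @^-1` E `&` C).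
  pose m : {measure set (R * R)%type -> \bar R} := pushforward (mrestr P mC) Z.
  by exists (m mZ).
pose m2 : {measure set (R * R)%type -> \bar R} :=
  mscale (NngNum PC0) (distribution P Z).
have m2E E : m2 E = P (Z @^-1` E) * P C.
  by rewrite /m2/= /mscale/= fineK ?fin_num_measure// muleC.
rewrite -[RHS]/(P (Z @^-1` D) * P C) -m2E -[LHS]/(P (Z @^-1` D `&` C)) -m1E.
apply: (measure_unique [set A `*` B | A in measurable & B in measurable]
  (fun=> setT)) => //.
- by rewrite measurable_prod_measurableType; reflexivity.
- move=> _ _ [A mA [B mB <-]] [A' mA' [B' mB' <-]].
  exists (A `&` A'); first exact: measurableI.
  exists (B `&` B'). exact: measurableI.
  by apply/seteqP; split => -[x y] /= [[? ?] [? ?]].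
- by move=> _; exists setT => //; exists setT => //; rewrite setXTT.
- by apply/seteqP; split => // z _; exists 0%N.
- by move=> _ [A mA [B mB <-]]; rewrite m1E m2E; exact: XYC.
- move=> _; rewrite m1E preimage_setT setTI (le_lt_trans _ (ltry 1))//.
  exact: probability_le1.
Qed.

Section Products.
Variables (n : nat) (Y : nat -> T -> R).
Hypothesis mY : forall i, measurable_fun setT (Y i).
Hypothesis indepY : forall k (B : nat -> set R), (forall i, measurable (B i)) ->
  P (\bigcap_(i in [set` index_iota k n.+1]) (Y i @^-1` B i)) =
  \prod_(k <= i < n.+1) P (Y i @^-1` B i).

Let X k w := (\prod_(i < k) Y i w)%R.

Let mX k : measurable_fun setT (X k).
Proof.
rewrite /X (_ : (fun w => _) = fun w => (\prod_(i <- iota 0 k) Y i w)%R).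
  exact: measurable_prod.
by apply/funext => w; rewrite -(big_mkord xpredT (Y ^~ w)) /index_iota subn0.
Qed.

Let mYB k B : measurable B -> measurable (Y k @^-1` B).
Proof. by move=> mB; rewrite -[_ @^-1` _]setTI; exact: mY. Qed.

(** Induction on [k], moving [Y k] from the tail into the product: [X k.+1] is a function of the
    pair [(X k, Y k)], which [independent_pair_event] separates from the event [C] on the later
    factors. *)
Let partial_product_independent k (A : set R) (B : nat -> set R) :
  (k <= n)%N -> measurable A -> (forall i, measurable (B i)) ->
  P (X k @^-1` A `&` \bigcap_(i in [set` index_iota k n.+1]) (Y i @^-1` B i)) =
  P (X k @^-1` A) * \prod_(k <= i < n.+1) P (Y i @^-1` B i).
Proof.
elim: k A B => [|k IHk] A B kn mA mB.
  have X0 : X 0 = cst 1%R by apply/funext => w; rewrite /X big_ord0.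
  rewrite X0 preimage_cst; case: ifPn => _.
    by rewrite setTI probability_setT mul1e indepY.
  by rewrite set0I measure0 mul0e.
pose C := \bigcap_(i in [set` index_iota k.+1 n.+1]) (Y i @^-1` B i).
have mC : measurable C by apply: fin_bigcap_measurable => // i _; exact: mYB.
have kn' : (k < n.+1)%N by rewrite (leq_trans kn).
have IH A' B' : measurable A' -> measurable B' ->
    P (X k @^-1` A' `&` Y k @^-1` B' `&` C) =
    P (X k @^-1` A') * P (Y k @^-1` B') * P C.
  move=> mA' mB'; pose B'' i := if i == k then B' else B i.
  have mB'' i : measurable (B'' i) by rewrite /B''; case: ifPn.
  have := IHk A' B'' (ltnW kn) mA' mB''.
  rewrite big_ltn// /B'' eqxx -/(B'' _).
  have -> : index_iota k n.+1 = k :: index_iota k.+1 n.+1.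
    by rewrite /index_iota subSS subSn ?(ltnW kn).
  rewrite (_ : [set` k :: _] = k |` [set` index_iota k.+1 n.+1]); last first.
    by apply/seteqP; split => i /=; rewrite inE => /predU1P.
  rewrite bigcap_setU1 /B'' eqxx setIA.
  rewrite (_ : \bigcap_(i in [set` index_iota k.+1 n.+1]) _ = C); last first.
    apply: eq_bigcapr => i /=; rewrite mem_index_iota => /andP[ki _].
    by rewrite gtn_eqF.
  move=> ->; rewrite muleA; congr (_ * _); rewrite indepY//.
  by apply: eq_big_nat => i /andP[ki _]; rewrite gtn_eqF.
rewrite -/C -indepY// -/C.
rewrite (_ : X k.+1 @^-1` A = (fun w => (X k w, Y k w)) @^-1`
    ((fun z : R * R => (z.1 * z.2)%R) @^-1` A)); last first.
  by apply/seteqP; split => w /=; rewrite /X big_ord_recr.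
apply: independent_pair_event => //.
- move=> A' B' mA' mB'; rewrite IH// ; congr (_ * _).
  (* With [setT] at all indices after [k], the induction hypothesis reduces to the independence of
     [X k] and [Y k]. *)
  have := IHk A' (fun i => if i == k then B' else setT) (ltnW kn) mA'.
  rewrite big_ltn// eqxx.
  rewrite (_ : \bigcap_(i in _) _ = Y k @^-1` B'); last first.
    apply/seteqP; split => w /=.
      move=> /(_ k); rewrite /= mem_index_iota leqnn kn' eqxx; exact.
    by move=> Ykw i _ /=; case: eqP => [->|].
  rewrite big_nat_cond big1 ?mule1 => [->//|i /andP[/andP[ki _] _]].
    by move=> i; case: ifPn.
  by rewrite gtn_eqF// preimage_setT probability_setT.
- rewrite -[X in measurable X]setTI.
  by apply: measurable_funM => //.
Qed.

Lemma product_independent (A B : set R) : measurable A -> measurable B ->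
  P ((fun w => \prod_(i < n) Y i w)%R @^-1` A `&` Y n @^-1` B) =
  P ((fun w => \prod_(i < n) Y i w)%R @^-1` A) * P (Y n @^-1` B).
Proof.
move=> mA mB.
have := @partial_product_independent n A (fun=> B) (leqnn _) mA (fun=> mB).
rewrite big_nat1 (_ : index_iota n n.+1 = [:: n]); last first.
  by rewrite /index_iota subSnn.
rewrite (_ : [set` [:: n]] = [set n]) ?bigcap_set1//.
by apply/seteqP; split => i /=; rewrite inE => /eqP.
Qed.

Lemma product_independent_integral (f : R * R -> \bar R) :
  measurable_fun setT f -> (forall z, 0 <= f z) ->
  \int[P]_w f ((\prod_(i < n) Y i w)%R, Y n w) =
  \int[P]_w \int[P]_w' f ((\prod_(i < n) Y i w)%R, Y n w').
Proof.
move=> mf f0.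
exact: (independent_integral (mX n) (mY n) product_independent).
Qed.

End Products.
End IndependentProducts.

(** * Summation over the pieces of one stick *)

Section StickBreakingSum.
Variables (R : realType) (d : measure_display) (T : measurableType d).
Variables (P : probability T R) (W : nat -> {RV P >-> R}).
Local Notation L := (@beta21 R).
Local Notation mu := (@lebesgue_measure R).
Hypothesis iidW : iid_with_law L W.
Local Open Scope ereal_scope.

Lemma integral_law_beta21 i (f : R -> \bar R) : measurable_fun setT f ->
  (forall x, 0 <= f x) -> \int[P]_w f (W i w) = \int[L]_x f x.
Proof.
move=> mf f0; transitivity (\int[distribution P (W i)]_x f x).
  by rewrite ge0_integral_distribution.
by apply: eq_measure_integral => A mA _; exact: iidW.1.
Qed.

(** This mean is the rate at which the remaining stick shrinks. The absolute value accounts for [W]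
    lying in [(0, 1)] only almost surely. *)
Lemma integral_beta21_norm : \int[L]_x `|x|%:E = (2 / 3)%:E.
Proof.
rewrite ge0_integral_beta21//; last first.
  by apply/measurable_EFinP; exact: normr_measurable.
transitivity (\int[mu]_(x in `[0%R, 1%R]) (2 * (x * x))%:E).
  apply: eq_integral => x; rewrite inE /= in_itv /= => /andP[x0 _].
  by rewrite -EFinM ger0_norm// mulrCA.
have dF (x : R) : is_derive x 1%R (fun x => 2 / 3 * (x * x * x))%R (2 * (x * x))%R.
  have did := is_derive_id x (1 : R)%R.
  have := is_derive_mulr (is_derive_cst (2 / 3 : R)%R x (1 : R)%R)
    (is_derive_mulr (is_derive_mulr did did) did).
  by move=> /is_derive_eq; apply; rewrite /cst /=; field.
have cF (x : R) : {for x, continuous (fun x : R => 2 / 3 * (x * x * x))%R}.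
  apply/differentiable_continuous/derivable1_diffP.
  by have [] := dF x.
have cf (x : R) : {for x, continuous (fun x : R => 2 * (x * x))%R}.
  apply: continuousM; first exact: cvg_cst.
  by apply: continuousM; exact: cvg_id.
rewrite (@continuous_FTC2 R _ (fun x => 2 / 3 * (x * x * x))%R)//.
- by rewrite -EFinB; congr EFin; ring.
- by apply: continuous_in_subspaceT => x _; exact: cf.
- split; first by move=> x _; have [] := dF x.
  + exact/cvg_at_right_filter/cF.
  + exact/cvg_at_left_filter/cF.
- by move=> x _; rewrite derive1E; have [_ ->] := dF x.
Qed.

(** The newest factor is averaged out under its law while the product of the earlier ones is
    frozen. *)
Lemma product_iid_integral n (f : R * R -> \bar R) :
  measurable_fun setT f -> (forall z, 0 <= f z) ->
  \int[P]_w f ((\prod_(i < n) W i w)%R, W n w) =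
  \int[P]_w \int[L]_x f ((\prod_(i < n) W i w)%R, x).
Proof.
move=> mf f0.
have mW i : measurable_fun setT (W i) by [].
rewrite (@product_independent_integral _ _ _ P n W mW)//; last first.
  by move=> k B mB; rewrite iidW.2// iota_uniq.
apply: eq_integral => w _.
rewrite (@integral_law_beta21 n (fun x => f ((\prod_(i < n) W i w)%R, x)))//.
exact: measurable_fun_pair2.
Qed.

Lemma measurable_prod_rv n : measurable_fun setT (fun w => \prod_(i < n) W i w)%R.
Proof.
rewrite (_ : (fun w => _) = fun w => (\prod_(i <- iota 0 n) W i w)%R).
  exact: measurable_prod.
by apply/funext => w; rewrite -(big_mkord xpredT (fun i => W i w)) /index_iota subn0.
Qed.

Lemma integral_prod_norm n :
  \int[P]_w `|\prod_(i < n) W i w|%:E = ((2 / 3) ^+ n)%:E.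
Proof.
elim: n => [|n IHn].
  under eq_integral do rewrite big_ord0 normr1.
  by rewrite integral_cst// mul1e expr0; exact: probability_setT.
under eq_integral do rewrite big_ord_recr /=.
have mnorm : measurable_fun setT (fun x : R => `|x|%:E).
  by apply/measurable_EFinP; exact: normr_measurable.
rewrite (@product_iid_integral n (fun z => `|z.1 * z.2|%:E))//; last first.
  apply/measurable_EFinP/measurableT_comp; first exact: normr_measurable.
  exact: measurable_funM.
transitivity (\int[P]_w ((2 / 3)%:E * `|\prod_(i < n) W i w|%:E)).
  apply: eq_integral => w _; under eq_integral do rewrite /= normrM EFinM.
  by rewrite ge0_integralZl_EFin// integral_beta21_norm muleC.
rewrite ge0_integralZl_EFin//; first by rewrite IHn -EFinM exprS.
exact: (measurableT_comp mnorm (measurable_prod_rv n)).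
Qed.

Lemma measurable_stick_breaking r : measurable_fun setT (stick_breaking W r).
Proof.
apply: measurable_funM; first exact: measurable_prod_rv.
by apply: measurable_funB.
Qed.

Lemma measurable_EFin_tboxfun d' (T' : measurableType d')
  (f : T' -> R) m k : measurable_fun setT f ->
  measurable_fun setT (fun w => (tboxfun m k (f w))%:E).
Proof.
move=> mf; apply/measurable_EFinP.
exact: (measurableT_comp (measurable_tboxfun m k) mf).
Qed.

(* By [expectation_tboxfun] the partial sums telescope, and the remainder after
   [n] terms is at most [2 * `|u| * (2 / 3) ^+ n]. *)
Lemma stick_breaking_sum m k (u : R) :
  \sum_(0 <= r <oo) \int[P]_w (tboxfun m k (u * stick_breaking W r w))%:E =
  (2 * tboxfun m.+1 k.+1 u)%:E.
Proof.
pose g (v : R) : R := (2 * tboxfun m.+1 k.+1 v)%R.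
pose a r := \int[P]_w (tboxfun m k (u * stick_breaking W r w))%:E.
pose M r := \int[P]_w (g (u * \prod_(i < r) W i w))%:E.
have g0 v : (0 <= g v)%R by rewrite mulr_ge0// tboxfun_ge0.
have mg : measurable_fun setT g.
  by apply: measurable_funM => //; exact: measurable_tboxfun.
have a0 r : 0 <= a r by apply: integral_ge0 => w _; rewrite lee_fin tboxfun_ge0.
(* This is [expectation_tboxfun] at [u] times the first [r] factors, integrated over these
   factors. *)
have aM r : a r + M r.+1 = M r.
  rewrite -ge0_integralD//; last 4 first.
  - by move=> w _; rewrite lee_fin tboxfun_ge0.
  - apply/measurable_EFinP/(measurableT_comp (measurable_tboxfun m k)).
    by apply: measurable_funM => //; exact: measurable_stick_breaking.
  - by move=> w _; rewrite lee_fin.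
  - apply/measurable_EFinP/(measurableT_comp mg).
    by apply: measurable_funM => //; exact: measurable_prod_rv.
  pose F (z : R * R) :=
    (tboxfun m k (u * z.1 * (1 - z.2)) + g (u * z.1 * z.2))%:E.
  transitivity (\int[P]_w F ((\prod_(i < r) W i w)%R, W r w)).
    by apply: eq_integral => w _; rewrite /F /stick_breaking big_ord_recr /= !mulrA.
  rewrite product_iid_integral//.
  - apply: eq_integral => w _; rewrite /F /g /=.
    exact: (expectation_tboxfun m k (u * \prod_(i < r) W i w)%R).
  - apply/measurable_EFinP; apply: measurable_funD.
      apply: (measurableT_comp (measurable_tboxfun m k)).
      apply: measurable_funM; first exact: measurable_funM.
      exact: measurable_funB.
    apply: (measurableT_comp mg).
    by apply: measurable_funM => //; exact: measurable_funM.
  - by move=> z; rewrite lee_fin addr_ge0// tboxfun_ge0.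
have M_le n : M n <= (2 * `|u| * (2 / 3) ^+ n)%:E.
  rewrite EFinM -integral_prod_norm -ge0_integralZl_EFin//; last first.
    by apply/measurable_EFinP/measurableT_comp => //; exact: measurable_prod_rv.
  apply: ge0_le_integral => //.
  - by move=> w _; rewrite lee_fin.
  - apply/measurable_EFinP/(measurableT_comp mg).
    by apply: measurable_funM => //; exact: measurable_prod_rv.
  - apply/measurable_EFinP; apply: measurable_funM => //.
    by apply: measurableT_comp => //; exact: measurable_prod_rv.
  - move=> w _; rewrite -EFinM lee_fin -mulrA -normrM ler_pM2l//.
    set v := (u * _)%R; have [v0|v0] := leP 0%R v.
      by rewrite ger0_norm// tboxfun_le.
    rewrite /tboxfun ifF ?normr_ge0//; apply/negbTE.
    by rewrite -ltNge (lt_trans v0).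
(* Finiteness makes the subtraction in the telescoped sum [sumE] legitimate in the extended
   reals. *)
have Mfin n : M n \is a fin_num.
  rewrite ge0_fin_numE; first by rewrite (le_lt_trans (M_le n))// ltry.
  by apply: integral_ge0 => w _; rewrite lee_fin.
have M00 : M 0%N = (g u)%:E.
  rewrite /M; under eq_integral do rewrite big_ord0 mulr1.
  rewrite integral_cst// [X in _ * X](_ : _ = 1) ?mule1//.
  exact: probability_setT.
have sumE n : \sum_(0 <= r < n) a r = M 0%N - M n.
  suff <- : \sum_(0 <= r < n) a r + M n = M 0%N by rewrite addeK.
  elim: n => [|n IHn]; first by rewrite big_nil add0e.
  by rewrite big_nat_recr//= -addeA aM.
have Mcvg : M n @[n --> \oo] --> 0.
  apply: (@squeeze_cvge _ _ _ _ (cst 0) _ (fun n => (2 * `|u| * (2 / 3) ^+ n)%:E)).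
  - apply: nearW => n; rewrite M_le andbT.
    by apply: integral_ge0 => w _; rewrite lee_fin.
  - exact: cvg_cst.
  - apply/fine_cvgP; split; first exact: nearW.
    have cvg0 : (fun n => (2 / 3) ^+ n : R)%R @ \oo --> (0 : R)%R.
      by apply: cvg_expr; rewrite ger0_norm// ltr_pdivrMr// mul1r ltr_nat.
    by have := cvgM (cvg_cst (2 * `|u| : R)%R) cvg0; rewrite mulr0; apply.
have cvg_sum : M 0%N - M n @[n --> \oo] --> (g u)%:E.
  rewrite -[(g u)%:E]sube0 -M00.
  have dM : M 0%N +? - 0 by rewrite M00.
  exact: (cvgeB dM (cvg_cst _) Mcvg).
apply/cvg_lim => //; apply: cvg_trans cvg_sum.
by apply: near_eq_cvg; apply: nearW => n; rewrite -sumE.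
Qed.

End StickBreakingSum.

(** * One generation of the nested scheme *)

Section NestedSticks.
Variables (R : realType) (d0 : measure_display) (T0 : measurableType d0).
Variables (P0 : probability T0 R) (W : nat -> {RV P0 >-> R}).
Variables (d : measure_display) (T : measurableType d) (P : probability T R).
Variable p : seq nat -> nat -> {RV P >-> R}.
Hypothesis iidW : iid_with_law (@beta21 R) W.
Hypothesis copies : independent_copies P0 (stick_breaking W) p.
Local Open Scope ereal_scope.

Lemma seq_sigma_algebra_coord r (B : set R) : measurable B ->
  seq_sigma_algebra [set x : nat -> R | B (x r)].
Proof. by move=> mB; apply: sub_sigma_algebra; exists r, B. Qed.

Lemma integral_copies v r (f : R -> \bar R) : measurable_fun setT f ->
  (forall x, 0 <= f x) ->
  \int[P]_w f (p v r w) = \int[P0]_w f (stick_breaking W r w).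
Proof.
move=> mf f0.
pose X : {RV P0 >-> R} := mfun_Sub (mem_set (measurable_stick_breaking W r)).
transitivity (\int[distribution P (p v r)]_x f x).
  by rewrite ge0_integral_distribution.
transitivity (\int[distribution P0 X]_x f x); last first.
  by rewrite ge0_integral_distribution.
apply: eq_measure_integral => A mA _.
exact: (copies.1 v _ (seq_sigma_algebra_coord r mA)).
Qed.

(** The prefixes of [v] have different lengths, hence are different words, and a single coordinate
    is read from the family attached to each of them. *)
Lemma factors_independent n (v : seq nat) k (B : nat -> set R) :
  size v = n.+1 -> (forall i, measurable (B i)) ->
  P (\bigcap_(i in [set` index_iota k n.+1])
       (p (take i v) (nth 0%N v i) @^-1` B i)) =
  \prod_(k <= i < n.+1) P (p (take i v) (nth 0%N v i) @^-1` B i).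
Proof.
move=> sv mB.
have sz i : i \in index_iota k n.+1 -> size (take i v) = i.
  by rewrite mem_index_iota => /andP[_ iv]; rewrite size_takel// sv ltnW.
(* The events must be indexed by words, so the position of a prefix is recovered from its length. *)
pose A (u : seq nat) := [set x : nat -> R | B (size u) (x (nth 0%N v (size u)))].
have mA u : seq_sigma_algebra (A u) by exact: seq_sigma_algebra_coord.
have us : uniq (map (take^~ v) (index_iota k n.+1)).
  rewrite map_inj_in_uniq ?iota_uniq// => i j /sz {2}<- /sz {2}<-.
  by move=> ->.
have := copies.2 _ A us mA.
rewrite big_map (_ : [set` map _ _] = (take^~ v) @` [set` index_iota k n.+1]).
  rewrite bigcap_image => h; rewrite [RHS](_ : _ =
      \prod_(i <- index_iota k n.+1)
        P [set w | A (take i v) (fun r => p (take i v) r w)]).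
    rewrite -h; congr (P _); apply: eq_bigcapr => i /= /sz szi.
    by apply/seteqP; split => w; rewrite /A /= szi.
  apply: eq_big_seq => i /sz szi; congr (P _).
  by apply/seteqP; split => w; rewrite /A /= szi.
apply/seteqP; split => u /=.
  by move=> /mapP[i ii ->]; exists i.
by move=> [i ii <-]; exact: map_f.
Qed.

Lemma measurable_box_prob v : measurable_fun setT (box_prob p v).
Proof.
rewrite (_ : box_prob p v = fun w =>
    (\prod_(i <- iota 0 (size v)) p (take i v) (nth 0%N v i) w)%R).
  exact: measurable_prod.
apply/funext => w; rewrite /box_prob.
by rewrite -(big_mkord xpredT (fun i => p (take i v) (nth 0%N v i) w))
  /index_iota subn0.
Qed.

(** The factors of [box_prob p v] belong to the proper prefixes of [v], so they are independent of
    the family attached to [v] itself. *)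
Lemma integral_box_prob_rcons v r (f : R * R -> \bar R) :
  measurable_fun setT f -> (forall z, 0 <= f z) ->
  \int[P]_w f (box_prob p v w, p v r w) =
  \int[P]_w \int[P]_w' f (box_prob p v w, p v r w').
Proof.
move=> mf f0; set n := size v; set v' := rcons v r.
have sv' : size v' = n.+1 by rewrite size_rcons.
pose Y i : T -> R := p (take i v') (nth 0%N v' i).
have mY i : measurable_fun setT (Y i) by [].
have YE : p v r = Y n :> (T -> R).
  by rewrite /Y nth_rcons ltnn eqxx /v' -cats1 takel_cat// take_size.
have bE : box_prob p v = fun w => (\prod_(i < n) Y i w)%R.
  apply/funext => w; apply: eq_bigr => i _.
  rewrite /Y nth_rcons ltn_ord /v' -cats1 takel_cat//.
  exact/ltnW.
rewrite YE bE; apply: (@product_independent_integral _ _ _ P n Y mY) => //.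
by move=> k B mB; exact: factors_independent.
Qed.

Definition mean_tboxfun m k (t : R) v : \bar R :=
  \int[P]_w (tboxfun m k (t * box_prob p v w))%:E.

Lemma mean_tboxfun_ge0 m k t v : 0 <= mean_tboxfun m k t v.
Proof. by apply: integral_ge0 => w _; rewrite lee_fin tboxfun_ge0. Qed.

Lemma mean_tboxfun_nil m k t : mean_tboxfun m k t [::] = (tboxfun m k t)%:E.
Proof.
rewrite /mean_tboxfun; under eq_integral do rewrite box_prob_nil mulr1.
by rewrite integral_cst// [X in _ * X](_ : _ = 1) ?mule1//; exact: probability_setT.
Qed.

(** With [box_prob p v w] frozen, the children of [v] are the pieces of a fresh stick, and
    [stick_breaking_sum] applies with [u = t * box_prob p v w]. *)
Lemma mean_tboxfun_rcons m k t v :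
  \sum_(0 <= r <oo) mean_tboxfun m k t (rcons v r) =
  2%:E * mean_tboxfun m.+1 k.+1 t v.
Proof.
pose f (z : R * R) := (tboxfun m k (t * z.1 * z.2))%:E.
have mf : measurable_fun setT f.
  by apply: measurable_EFin_tboxfun; apply: measurable_funM => //;
    exact: measurable_funM.
have f0 z : 0 <= f z by rewrite lee_fin tboxfun_ge0.
transitivity (\sum_(0 <= r <oo)
    \int[P]_w \int[P]_w' f (box_prob p v w, p v r w')).
  apply: eq_eseriesr => r _; rewrite -integral_box_prob_rcons//.
  by apply: eq_integral => w _; rewrite box_prob_rcons mulrA.
rewrite -integral_nneseries//; last 2 first.
- move=> r; pose f' (z : R * T) := f (z.1, p v r z.2).
  have mf' : measurable_fun setT f'.
    apply: (measurableT_comp mf); apply: measurable_fun_pair => //.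
    exact: measurableT_comp.
  have f'0 z : 0 <= f' z by exact: f0.
  have mF := @measurable_fun_fubini_tonelli_F _ _ R T R P f' mf' f'0.
  exact: (measurableT_comp mF (measurable_box_prob v)).
- by move=> r w _; exact: integral_ge0.
rewrite -ge0_integralZl_EFin//; last 2 first.
- by move=> w _; rewrite lee_fin tboxfun_ge0.
- apply: measurable_EFin_tboxfun; apply: measurable_funM => //.
  exact: measurable_box_prob.
apply: eq_integral => w _; rewrite -EFinM -(stick_breaking_sum iidW).
apply: eq_eseriesr => r _.
rewrite (@integral_copies v r (fun y => f (box_prob p v w, y)))//.
exact: measurable_fun_pair2.
Qed.

End NestedSticks.

(** * Sums over all words of a given length *)

Section WordSum.
Variable R : realType.
Implicit Type a : seq nat -> \bar R.
Local Open Scope ereal_scope.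

(** An iterated series with the last letter innermost, so that the youngest generation is summed out
    first, in step with [mean_tboxfun_rcons]. *)
Fixpoint word_sum j a : \bar R :=
  if j is j'.+1 then word_sum j' (fun v => \sum_(0 <= r <oo) a (rcons v r))
  else a [::].

Lemma eq_word_sum j a b : (forall v, size v = j -> a v = b v) ->
  word_sum j a = word_sum j b.
Proof.
elim: j a b => [|j IHj] a b ab /=; first exact: ab.
apply: IHj => v sv; apply: eq_eseriesr => r _; apply: ab.
by rewrite size_rcons sv.
Qed.

Lemma word_sum_esum j a : (forall v, 0 <= a v) ->
  word_sum j a = \esum_(v in [set v | size v = j]) a v.
Proof.
elim: j a => [|j IHj] a a0 /=.
  rewrite (_ : [set v | size v = 0%N] = [set [::]]) ?esum_set1//.
  by apply/seteqP; split => [v /size0nil|v ->].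
rewrite IHj; last by move=> v; exact: nneseries_ge0.
under eq_esum do rewrite nneseries_esumT//.
rewrite esum_esum//; apply/esym.
apply: (@reindex_esum _ _ _ _ _ (fun x : seq nat * nat => rcons x.1 x.2)).
split.
- by move=> [v r] /= [sv _]; rewrite size_rcons sv.
- move=> [v r] [v' r'] _ _ /= /eqP; rewrite eqseq_rcons.
  by move=> /andP[/eqP -> /eqP ->].
- move=> v /= sv; case/lastP: v sv => [//|v r].
  by rewrite size_rcons => -[sv]; exists (v, r).
Qed.

Lemma counting_esum (I : choiceType) (A : set I) :
  counting A = \esum_(i in A) (1 : \bar R).
Proof.
rewrite /counting; case: ifPn => /asboolP finA.
  by rewrite esum_fset// card_fset_sum1// natr_sum -sumEFin fsbig_finite.
(* For infinite [A], a finite subset with more than [r] elements bounds the sum from below by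
   [r]. *)
apply/esym/eqyP => r r0.
have [X XA Xr] := infinite_set_fset (Num.truncn r).+1 finA.
apply: esum_ge; refine (ex_intro2 _ _ _ (conj (finite_fset X) XA) _).
apply: (@le_trans _ _ (Num.truncn r).+1%:R%:E).
  by rewrite lee_fin ltW// truncnS_gt.
move: Xr; rewrite -(@ler_nat R) -lee_fin => /le_trans; apply.
by rewrite fsbig_finite//= card_fset_sum1 sumEFin natr_sum// set_fsetK.
Qed.

Lemma integral_word_sum (d : measure_display) (T : measurableType d)
    (P : {measure set T -> \bar R}) j (h : seq nat -> T -> \bar R) :
  (forall v, measurable_fun setT (h v)) -> (forall v w, 0 <= h v w) ->
  \int[P]_w word_sum j (h^~ w) = word_sum j (fun v => \int[P]_w h v w).
Proof.
elim: j h => [//|j IHj] h mh h0 /=.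
rewrite (IHj (fun v w => \sum_(0 <= r <oo) h (rcons v r) w)); last 2 first.
- by move=> v; exact: ge0_emeasurable_sum.
- by move=> v w; exact: nneseries_ge0.
by apply: eq_word_sum => v _; rewrite integral_nneseries.
Qed.

End WordSum.

(** * The exact mean of the number of boxes *)

Section MeanBoxCount.
Variables (R : realType) (d0 : measure_display) (T0 : measurableType d0).
Variables (P0 : probability T0 R) (W : nat -> {RV P0 >-> R}).
Variables (d : measure_display) (T : measurableType d) (P : probability T R).
Variable p : seq nat -> nat -> {RV P >-> R}.
Hypothesis iidW : iid_with_law (@beta21 R) W.
Hypothesis copies : independent_copies P0 (stick_breaking W) p.
Local Open Scope ereal_scope.

(** Each generation raises both indices by one and contributes a factor 2, which the constant [c]
    absorbs in the induction. *)
Lemma word_sum_mean_tboxfun j m k (c t : R) : (0 <= c)%R ->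
  word_sum j (fun v => c%:E * mean_tboxfun p m k t v) =
  (c * 2 ^+ j * tboxfun (m + j) (k + j) t)%:E.
Proof.
elim: j m k c => [|j IHj] m k c c0.
  by rewrite /= mean_tboxfun_nil !addn0 expr0 mulr1 EFinM.
rewrite exprS mulrA -!addSnnS -IHj ?mulr_ge0//=.
apply: eq_word_sum => v _.
rewrite nneseriesZl; last by move=> r _; exact: mean_tboxfun_ge0.
by rewrite (mean_tboxfun_rcons iidW copies) EFinM muleA.
Qed.

Lemma mean_box_countE j (t : R) : (1 <= t)%R ->
  mean_box_count p j t = (2 ^+ j * boxfun j j.+1 t)%:E.
Proof.
move=> t1; have t0 : (0 < t)%R by exact: lt_le_trans t1.
(* The indicator [tboxfun 0 0] at [t * box_prob p v w] tests whether the box [v] is counted. *)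
have cE w : box_count p j t w =
    word_sum j (fun v => (tboxfun 0 0 (t * box_prob p v w))%:E).
  rewrite word_sum_esum; last by move=> v; rewrite lee_fin tboxfun_ge0.
  rewrite /box_count counting_esum.
  rewrite (_ : [set v | _ /\ _] = [set v : seq nat | size v = j] `&`
      [set v | (t^-1 <= box_prob p v w)%R])//.
  rewrite esum_mkcondr; apply: eq_esum => v _.
  rewrite /tboxfun -[(1 <= _)%R]ler_pdivrMl// mulr1.
  rewrite (_ : (v \in _) = (t^-1 <= box_prob p v w)%R); last first.
    by apply/idP/idP; rewrite inE.
  by case: ifPn => //= _; rewrite /lnpow expr0 fact0 divr1.
rewrite /mean_box_count; under eq_integral do rewrite cE.
rewrite integral_word_sum.
- transitivity (word_sum j (fun v => 1%:E * mean_tboxfun p 0 0 t v)).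
    by apply: eq_word_sum => v _; rewrite mul1e.
  by rewrite word_sum_mean_tboxfun// mul1r !add0n /tboxfun t1.
- move=> v; apply: measurable_EFin_tboxfun; apply: measurable_funM => //.
  exact: measurable_box_prob.
- by move=> v w; rewrite lee_fin tboxfun_ge0.
Qed.

End MeanBoxCount.

(** * Moments of [ln W] and [ln (1 - W)] under [beta21] *)

Section LogMoments.
Variable R : realType.
Implicit Types (x b c : R).
Local Notation mu := (@lebesgue_measure R).
Local Notation L := (@beta21 R).

(** It follows from [ln y <= y - 1] at [y = (Num.sqrt x)^-1], with the convention [ln 0 = 0] at the
    endpoint. It controls both [x * ln x] near 0 and [x * ln x ^+ 2]. *)
Lemma sqrt_norm_ln_le x : 0 <= x -> x <= 1 -> Num.sqrt x * `|ln x| <= 2.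
Proof.
rewrite le_eqVlt => /predU1P[<- _|x0 x1]; first by rewrite ln0// normr0 mulr0.
have s0 : 0 < Num.sqrt x by rewrite sqrtr_gt0.
have lnE : ln x = 2 * ln (Num.sqrt x).
  by rewrite mulr_natl -lnXn// sqr_sqrtr// ltW.
have := @le_ln1Dx R ((Num.sqrt x)^-1 - 1).
rewrite ltrBDl subrr invr_gt0 => /(_ s0).
rewrite addrC subrK lnV// => h.
rewrite ler0_norm ?ln_le0// lnE -mulrN mulrCA -[leRHS]mulr1 ler_pM2l//.
rewrite -ler_pdivlMl// mulr1 (le_trans h)// gerBl ler01//.
Qed.

Lemma cvg_mul_ln0 : x * ln x @[x --> (0 : R)^'+] --> (0 : R).
Proof.
have sqrt0 c : c * Num.sqrt x @[x --> (0 : R)^'+] --> (0 : R).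
  have h : Num.sqrt x @[x --> (0 : R)^'+] --> (0 : R).
    by apply: cvg_at_right_filter; rewrite -[X in _ --> X]sqrtr0; exact: sqrt_continuous.
  by have := cvgM (cvg_cst c) h; rewrite mulr0; apply.
apply: (@squeeze_cvgr _ _ _ _ (fun x => -2 * Num.sqrt x) (fun x => 2 * Num.sqrt x)).
- near=> x.
  have x0 : 0 < x by near: x; exact: nbhs_right_gt.
  have x1 : x <= 1 by apply/ltW; near: x; exact: nbhs_right_lt.
  rewrite mulNr -ler_norml normrM gtr0_norm//.
  rewrite -{1}[x](sqr_sqrtr (ltW x0)) expr2 -mulrA [leRHS]mulrC.
  by rewrite ler_pM2l ?sqrtr_gt0// sqrt_norm_ln_le// ltW.
- exact: sqrt0.
- exact: sqrt0.
Unshelve. all: by end_near. Qed.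

Lemma continuous_mul_ln x : 0 < x -> {for x, continuous (fun x => x * ln x)}.
Proof. by move=> x0; apply: continuousM; [exact: cvg_id|exact: continuous_ln]. Qed.

Lemma within_continuous_mul_ln c :
  {within `[0, 1], continuous (fun x => c * (x * ln x))}.
Proof.
have ct x : 0 < x -> {for x, continuous (fun x => c * (x * ln x))}.
  by move=> x0; apply: continuousM; [exact: cvg_cst|exact: continuous_mul_ln].
apply/continuous_within_itvP => //; split.
- by move=> x; rewrite in_itv /= => /andP[x0 _]; exact: ct.
- rewrite mul0r mulr0.
  by have := cvgM (cvg_cst c) cvg_mul_ln0; rewrite mulr0; apply.
- exact/cvg_at_left_filter/ct.
Qed.

Lemma expectation_norm_ln : ('E_L[fun x => `|ln x|%R] = (2^-1)%:E)%E.
Proof.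
rewrite expectation.unlock ge0_integral_beta21; last 2 first.
- apply/measurable_EFinP; apply: measurableT_comp; first exact: normr_measurable.
  exact: measurable_ln.
- by move=> x; rewrite lee_fin.
transitivity (\int[mu]_(x in `[0%R, 1%R]) (- 2 * (x * ln x))%:E)%E.
  apply: eq_integral => x; rewrite inE /= in_itv /= => /andP[x0 x1].
  by rewrite -EFinM ler0_norm ?ln_le0//; congr EFin; ring.
(* The primitive of [- 2 * (x * ln x)] that tends to 0 at 0. *)
pose F x : R := x * x / 2 - x * (x * ln x).
have dF x : 0 < x -> is_derive x 1 F (- 2 * (x * ln x)).
  move=> x0; have did := is_derive_id x (1 : R).
  have := is_deriveB
    (is_derive_mulr (is_derive_mulr did did) (is_derive_cst (2^-1 : R) x (1 : R)))
    (is_derive_mulr did (is_derive_mulr did (is_derive1_ln x0))).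
  by move=> /is_derive_eq; apply; rewrite /cst /=; field; rewrite gt_eqF.
have cF x : 0 < x -> {for x, continuous F}.
  move=> x0; apply/differentiable_continuous/derivable1_diffP.
  by have [] := dF x x0.
rewrite (@continuous_FTC2 R _ F)//.
- by rewrite -EFinB; congr EFin; rewrite /F ln1; field.
- exact: within_continuous_mul_ln.
- split.
  + by move=> x; rewrite in_itv /= => /andP[x0 _]; have [] := dF x x0.
  + have idc : x @[x --> (0 : R)^'+] --> (0 : R) by exact/cvg_at_right_filter/cvg_id.
    have := cvgB (cvgM (cvgM idc idc) (cvg_cst (2^-1 : R))) (cvgM idc cvg_mul_ln0).
    by rewrite /F !mul0r subrr; apply.
  + exact/cvg_at_left_filter/cF.
- move=> x; rewrite in_itv /= => /andP[x0 _]; rewrite derive1E.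
  by have [_ ->] := dF x x0.
Qed.

(** The mean is kept as an abstract [c]: the bounds derived from this formula hold for every real
    [c]. *)
Lemma variance_ln_integral : exists c : R, ('V_L[@ln R] =
  \int[mu]_(x in `[0%R, 1%R]) ((ln x - c) ^+ 2 * (2 * x))%:E)%E.
Proof.
exists (fine 'E_L[@ln R]%E); set c := fine _.
rewrite /variance covariance.unlock -/c expectation.unlock.
rewrite ge0_integral_beta21//.
- by apply/measurable_EFinP; apply: measurable_funM; exact: measurable_funB.
- by move=> x; rewrite lee_fin /= -expr2 sqr_ge0.
Qed.

Lemma variance_ln_lty : ('V_L[@ln R] < +oo)%E.
Proof.
have [c ->] := variance_ln_integral.
(* Since [(a - b)^2 <= 2 a^2 + 2 b^2], the integrand is at most
   [4 * x * ln x ^+ 2 + 4 * x * c ^+ 2], and [x * ln x ^+ 2 <= 4] by [sqrt_norm_ln_le]. *)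
apply: (@le_lt_trans _ _ (\int[mu]_(x in `[0%R, 1%R]) (16 + 4 * c ^+ 2)%:E)%E).
  apply: ge0_le_integral => //.
  - move=> x; rewrite /= in_itv /= => /andP[x0 _].
    by rewrite lee_fin mulr_ge0 ?sqr_ge0// mulr_ge0.
  - apply/measurable_EFinP/measurable_funTS; apply: measurable_funM => //.
    by apply: measurable_funX; exact: measurable_funB.
  - move=> x; rewrite /= in_itv /= => /andP[x0 x1]; rewrite lee_fin.
    have h : x * ln x ^+ 2 <= 4.
      rewrite -{1}[x]sqr_sqrtr// -[ln x ^+ 2]real_normK ?num_real// -exprMn.
      have := sqrt_norm_ln_le x0 x1; set y := _ * _ => y2.
      have y0 : 0 <= y by rewrite mulr_ge0.
      have -> : (4 : R) = 2 ^+ 2 by rewrite -natrX.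
      by rewrite lerXn2r ?nnegrE.
    have := sqr_ge0 (ln x + c); have := sqr_ge0 c => c2 lc.
    have xc : x * c ^+ 2 <= c ^+ 2 by rewrite ler_piMl.
    have := mulr_ge0 x0 lc.
    lra.
by rewrite integral_cst//= lebesgue_measure_itv /= lte01 oppr0 adde0 mule1 ltry.
Qed.

(* Whatever [c] is, [ln] stays at distance at least 1/2 from [c] on
   [[e^-2, e^(-3/2)]] or on [[e^(-1/2), 1]]. *)
Lemma variance_ln_gt0 : (0 < 'V_L[@ln R])%E.
Proof.
have [c ->] := variance_ln_integral.
have pos a b : 0 < a -> a < b -> b <= 1 ->
    (forall x, a <= x -> x <= b -> 4^-1 <= (ln x - c) ^+ 2) ->
    (0 < \int[mu]_(x in `[0%R, 1%R]) ((ln x - c) ^+ 2 * (2 * x))%:E)%E.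
  move=> a0 ab b1 h.
  apply: (@lt_le_trans _ _ (\int[mu]_(x in `[a, b]) (4^-1 * (2 * a))%:E)%E).
    rewrite integral_cst//= lebesgue_measure_itv /= lte_fin ab -EFinB -EFinM.
    by rewrite lte_fin !mulr_gt0// subr_gt0.
  apply: (@le_trans _ _
      (\int[mu]_(x in `[a, b]) ((ln x - c) ^+ 2 * (2 * x))%:E)%E).
    apply: ge0_le_integral => //.
    - by move=> x _; rewrite lee_fin !mulr_ge0// ltW.
    - apply/measurable_EFinP/measurable_funTS; apply: measurable_funM => //.
      by apply: measurable_funX; exact: measurable_funB.
    - move=> x; rewrite /= in_itv /= => /andP[ax xb]; rewrite lee_fin.
      by apply: ler_pM; rewrite ?invr_ge0 ?mulr_ge0 ?h ?ler_pM2l// ltW.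
  apply: ge0_subset_integral => //.
  - apply/measurable_EFinP/measurable_funTS; apply: measurable_funM => //.
    by apply: measurable_funX; exact: measurable_funB.
  - move=> x; rewrite /= in_itv /= => /andP[x0 _].
    by rewrite lee_fin mulr_ge0 ?sqr_ge0// mulr_ge0.
  - move=> x; rewrite /= !in_itv /= => /andP[ax xb].
    by rewrite (le_trans _ ax) ?(le_trans xb)// ltW.
have sq (y : R) : 2^-1 <= `|y| -> 4^-1 <= y ^+ 2.
  move=> y2; rewrite -real_normK ?num_real//.
  have := lerXn2r 2 _ _ y2; rewrite !nnegrE => /(_ _ _).
  by rewrite exprVn -natrX; apply => //.
have lnle x y : 0 < x -> x <= y -> ln x <= ln y.
  by move=> x0 xy; rewrite ler_ln ?posrE// (lt_le_trans x0).
(* The threshold -1 is the midpoint of -3/2 and -1/2, at distance 1/2 from each. *)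
have [c1|c1] := leP (-1) c.
  apply: (pos (expR (-2)) (expR (- (3 / 2)))); rewrite ?expR_gt0//.
  - by rewrite ltr_expR; lra.
  - move=> x ax xb; apply: sq.
    have lx : ln x <= - (3 / 2).
      by rewrite -[leRHS]expRK lnle// (lt_le_trans _ ax)// expR_gt0.
    by rewrite ler0_norm; lra.
apply: (pos (expR (- (1 / 2))) 1); rewrite ?expR_gt0//.
move=> x xa _; apply: sq.
have lx : - (1 / 2) <= ln x by rewrite -[leLHS]expRK lnle// expR_gt0.
by rewrite ger0_norm; lra.
Qed.

(** The logarithmic term of the primitive [F] is nonpositive at [b], which leaves [b + b^2 / 2]. The
    bound is uniform in [b], as monotone convergence for [b] tending to 1 requires. *)
Lemma integral_norm_ln_onem b : 0 < b -> b < 1 ->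
  (\int[mu]_(x in `[0%R, b]) (`|ln (1 - x)| * (2 * x))%:E <= (3 / 2)%:E)%E.
Proof.
move=> b0 b1.
have lt1 x : x \in `[0, b] -> 0 < 1 - x.
  by rewrite in_itv /= => /andP[_ xb]; rewrite subr_gt0 (le_lt_trans xb).
rewrite (_ : (\int[mu]_(x in `[0%R, b]) _)%E =
    (\int[mu]_(x in `[0%R, b]) (- 2 * x * ln (1 - x))%:E)%E); last first.
  apply: eq_integral => x; rewrite inE /= in_itv /= => /andP[x0 x1].
  by rewrite ler0_norm ?ln_le0 ?gerBl//; congr EFin; ring.
pose F x : R := (1 - x * x) * ln (1 - x) + (x + x * x / 2).
have dF x : 0 < 1 - x -> is_derive x 1 F (- 2 * x * ln (1 - x)).
  move=> x0; have did := is_derive_id x (1 : R).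
  have d1 := is_derive_cst (1 : R) x (1 : R).
  have dl : is_derive x 1 (fun x => ln (1 - x)) ((1 - x)^-1 * (0 - 1)).
    apply: (@is_derive1_comp R (@ln R) (fun x => 1 - x)).
    exact: is_derive1_ln.
  have := is_deriveD
    (is_derive_mulr (is_deriveB d1 (is_derive_mulr did did)) dl)
    (is_deriveD did (is_derive_mulr (is_derive_mulr did did)
      (is_derive_cst (2^-1 : R) x (1 : R)))).
  move=> /is_derive_eq; apply; rewrite /cst /=.
  rewrite [((fun=> 1) - _) x](_ : _ = 1 - x * x)//; field.
  by rewrite gt_eqF.
have cF x : 0 < 1 - x -> {for x, continuous F}.
  move=> x0; apply/differentiable_continuous/derivable1_diffP.
  by have [] := dF x x0.
have cf x : 0 < 1 - x -> {for x, continuous (fun x => - 2 * x * ln (1 - x))}.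
  move=> x0; apply: continuousM.
    by apply: continuousM; [exact: cvg_cst|exact: cvg_id].
  apply: (@continuous_comp _ _ _ (fun x => 1 - x)); last exact: continuous_ln.
  by apply: continuousB; [exact: cvg_cst|exact: cvg_id].
have b1' : 0 < 1 - b by rewrite subr_gt0.
rewrite (@continuous_FTC2 R _ F)//.
- rewrite -EFinB lee_fin /F subr0 ln1 !mul0r mulr0 !addr0 subr0.
  have l0 : ln (1 - b) <= 0 by rewrite ln_le0// gerBl ltW.
  have bb : b * b <= 1 by rewrite -[leRHS]mulr1 ler_pM// ltW.
  have := mulr_ge0_le0 (_ : 0 <= 1 - b * b) l0; rewrite subr_ge0 => /(_ bb).
  lra.
- by apply: continuous_in_subspaceT => x; rewrite inE => /lt1; exact: cf.
- split.
  + by move=> x /subset_itv_oo_cc/lt1 x0; have [] := dF x x0.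
  + by apply/cvg_at_right_filter/cF; rewrite subr0.
  + exact/cvg_at_left_filter/cF.
- move=> x /subset_itv_oo_cc/lt1 x0; rewrite derive1E.
  by have [_ ->] := dF x x0.
Qed.

Lemma expectation_norm_ln_onem : ('E_L[fun x => `|ln (1 - x)|%R] < +oo)%E.
Proof.
have mf : measurable_fun setT (fun x : R => `|ln (1 - x)|).
  apply: measurableT_comp; first exact: normr_measurable.
  by apply: measurableT_comp; [exact: measurable_ln|exact: measurable_funB].
rewrite expectation.unlock ge0_integral_beta21; last 2 first.
- exact/measurable_EFinP.
- by move=> x; rewrite lee_fin.
have mf2 : measurable_fun setT (fun x : R => (`|ln (1 - x)| * (2 * x))%:E).
  by apply/measurable_EFinP; apply: measurable_funM.
under eq_integral do rewrite -EFinM.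
rewrite integral_itv_bndoo; last exact: measurable_funTS.
rewrite -(integral_itv_bndoo true true); last exact: measurable_funTS.
(* The intervals [[0, b n]] exhaust [[0, 1[]; the shift [n.+2] makes already [b 0] positive. *)
pose b n : R := 1 - n.+2%:R^-1.
have b0 n : 0 < b n by rewrite subr_gt0 invf_lt1 ?ltr1n.
have b1 n : b n < 1 by rewrite gtrBl.
rewrite (_ : [set` `[0, 1[] = \bigcup_n [set` `[0, b n]]); last first.
  apply/seteqP; split => x /=; rewrite in_itv /=.
    move=> /andP[x0 x1]; have [n xn] := ltr_add_invr x1.
    exists n => //=; rewrite in_itv /= x0 /= /b lerBrDr (le_trans _ (ltW xn))//.
    by rewrite lerD2l lef_pV2 ?posrE// ler_nat.
  by move=> [n _]; rewrite /= in_itv /= => /andP[-> /le_lt_trans]; apply.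
have nd : nondecreasing_seq (fun n => [set` `[0, b n]]).
  move=> m n mn; apply/subsetPset => x /=; rewrite !in_itv /= => /andP[-> xm] /=.
  by rewrite (le_trans xm)// lerD2l lerN2 lef_pV2 ?posrE// ler_nat.
have mb n : measurable [set` `[0, b n]] by [].
have f0 n x : [set` `[0, b n]] x -> (0 <= (`|ln (1 - x)| * (2 * x))%:E)%E.
  by rewrite /= in_itv /= => /andP[x0 _]; rewrite lee_fin mulr_ge0// mulr_ge0.
have mfb n : measurable_fun [set` `[0, b n]]
    (fun x => (`|ln (1 - x)| * (2 * x))%:E) by exact: measurable_funTS.
have cv := @ge0_nondecreasing_set_cvg_integral _ _ R _ _ mu nd mb mfb f0.
rewrite -(cvg_lim _ cv)// (@le_lt_trans _ _ (3 / 2)%:E)// ?ltry//.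
apply: lime_le; first by apply/cvg_ex; eexists; exact: cv.
by apply: nearW => n; exact: integral_norm_ln_onem.
Qed.

(** The interval [[0, 1]] has mass 1, and its endpoints are null because [beta_prob] is dominated by
    Lebesgue measure. *)
Lemma beta21_oo01 : L `]0, 1[%classic = 1%E.
Proof.
have null x : L [set x] = 0%E.
  rewrite -[LHS]/(beta_prob 2 1 [set x]).
  apply: (@beta_prob_dom R 2 1 [set x]) => // A mA Ax.
  apply/eqP; rewrite eq_le measure_ge0 andbT.
  rewrite -(lebesgue_measure_set1 x) le_measure ?inE//.
have le : (L `[0%R, 1%R]%classic <=
    L [set 0%R] + L `]0%R, 1%R[%classic + L [set 1%R])%E.
  rewrite (_ : `[0, 1]%classic = [set 0] `|` `]0, 1[ `|` [set 1]); last first.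
    apply/seteqP; split => x /=; rewrite !in_itv /=.
      move=> /andP[]; rewrite !le_eqVlt => /predU1P[<-|x0] /predU1P[->|x1].
      - by right.
      - by left; left.
      - by right.
      - by left; right; rewrite x0 x1.
    by move=> [[->|/andP[/ltW -> /ltW ->]]|->]; rewrite ?lexx ?ler01.
  apply: (le_trans (measureU2 L _ _)) => //; first exact: measurableU.
  by rewrite leeD2r// measureU2.
apply/eqP; rewrite eq_le probability_le1//=.
by move: le; rewrite !null add0e adde0; apply: le_trans; rewrite -(beta_prob01 2 1).
Qed.

End LogMoments.

(** * Asymptotics of the normalized error *)

Section ErrorAsymptotics.
Variable R : realType.
Implicit Types (x u : R) (k n : nat).

Let cbrtV x : R := x `^ (- 3^-1).

Let cbrtV_exp3 x : 0 < x -> cbrtV x ^+ 3 = x^-1.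
Proof.
move=> x0; rewrite -powR_mulrn ?powR_ge0// -powRrM -[x^-1]powR_inv1 ?ltW//.
by rewrite (_ : - 3^-1 * 3%:R = -1)//; field.
Qed.

Let sqrtV_cbrtV x : 0 < x -> (Num.sqrt x)^-1 = cbrtV x * Num.sqrt (cbrtV x).
Proof.
move=> x0; rewrite -sqrtrV ?ltW// -cbrtV_exp3// exprSr sqrtrM ?sqr_ge0//.
by rewrite sqrtr_sqr ger0_norm// powR_ge0.
Qed.

(** This is [normalized_error] for [mu = 1/2] after cancellation of the powers of 2. The absolute
    value is resolved by [boxfun_le_lnpow], which fixes the sign of the difference. *)
Definition scaled_error k u : R :=
  Num.sqrt k%:R * (k.-1)`!%:R * (lnpow k u - boxfun k k.+1 u)
  / ln u `^ (k%:R - 2^-1).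

(** The quantities [y] and [q] are chosen so that the leading term [k^(3/2) / (ln u)^(1/2)] equals
    [q^(3/2)] and the relative error [k^2 / ln u] equals [q^2 y]. The upper bound comes from
    [boxfun_lower], the lower one from [boxfun_upper]. *)
Lemma scaled_error_bounds k u : 1 < u -> (1 < k)%N ->
  let y := ln u `^ (- 3^-1) in let q := y * k%:R in
  q * Num.sqrt q * (1 - q ^+ 2 * y) <= scaled_error k u <= q * Num.sqrt q.
Proof.
move=> u1; case: k => [//|[//|k]] _ /=.
set x := ln u; rewrite -/(cbrtV x); set y := cbrtV x; set K : R := k.+2%:R.
have x0 : 0 < x by exact: ln_gt0.
have y0 : 0 < y by exact: powR_gt0.
have sx0 : 0 < Num.sqrt x by rewrite sqrtr_gt0.
have K0 : 0 < K by rewrite ltr0n.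
have rE : y * K * Num.sqrt (y * K) = K * Num.sqrt K / Num.sqrt x.
  by rewrite sqrtV_cbrtV// -/y sqrtrM ?ltW//; ring.
have sE : (y * K) ^+ 2 * y = K ^+ 2 / x.
  by rewrite -cbrtV_exp3// -/y; ring.
pose C := Num.sqrt K * k.+1`!%:R / (x ^+ k.+1 * Num.sqrt x).
have C0 : 0 < C.
  by rewrite divr_gt0// mulr_gt0 ?sqrtr_gt0 ?exprn_gt0// ltr0n fact_gt0.
have eE : scaled_error k.+2 u = C * (lnpow k.+2 u - boxfun k.+2 k.+3 u).
  rewrite /scaled_error -/x -/K /= (_ : K - 2^-1 = k.+1%:R + 2^-1).
    rewrite powRD ?gt_eqF ?implybT// powR_mulrn ?ltW// powR12_sqrt ?ltW//.
    by rewrite /C mulrAC.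
  by rewrite /K -[k.+2%:R]natr1; field.
have fn0 : k.+1`!%:R != 0 :> R by rewrite pnatr_eq0 -lt0n fact_gt0.
have CK : C * (K * lnpow k.+1 u) = K * Num.sqrt K / Num.sqrt x.
  rewrite /C /lnpow -/x; field.
  by rewrite expf_neq0 ?gt_eqF.
have Ck : C * lnpow k u = Num.sqrt K / Num.sqrt x * (k.+1%:R / x).
  rewrite /C /lnpow -/x factS natrM exprS; field.
  have kf : k`!%:R != 0 :> R by rewrite pnatr_eq0 -lt0n fact_gt0.
  by rewrite kf expf_neq0 ?gt_eqF.
have lb := boxfun_lower k.+2 k.+1 (ltW u1).
have ub := boxfun_upper k.+2 k (ltW u1).
rewrite rE sE eE -CK; move: (boxfun k.+2 k.+3 u) lb ub => b.
rewrite natrM -/K => lb ub; apply/andP; split; last by rewrite ler_pM2l//; lra.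
(* The second-order term, relative to the leading one, is [(k + 3) (k + 1) / (2 x)], and
   [(k + 3) (k + 1) / 2 <= (k + 2)^2]. *)
have tail : C * (K * k.+3%:R / 2 * lnpow k u) <= C * (K * lnpow k.+1 u) * (K ^+ 2 / x).
  rewrite CK mulrCA Ck.
  have -> : K * k.+3%:R / 2 * (Num.sqrt K / Num.sqrt x * (k.+1%:R / x)) =
      K * Num.sqrt K / Num.sqrt x * (k.+3%:R * k.+1%:R / 2 / x).
    by field; rewrite !gt_eqF.
  rewrite ler_pM2l; last by rewrite divr_gt0// mulr_gt0// sqrtr_gt0.
  rewrite ler_pM2r ?invr_gt0// /K -!natr1.
  have c0 : 0 <= k%:R :> R by [].
  have c2 := mulr_ge0 c0 c0.
  rewrite add0r -[1 + 1]/(2 : R); nra.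
have := ub; rewrite -(ler_pM2l C0); lra.
Qed.

Lemma normalized_errorE (m : nat -> R -> \bar R) (j : nat -> nat) n :
  (1 < n)%N ->
  m (j n) n%:R = (2 ^+ j n * boxfun (j n) (j n).+1 n%:R)%:E ->
  normalized_error 2^-1 m j n = (scaled_error (j n) n%:R)%:E.
Proof.
move=> n1 mE; rewrite /normalized_error mE; set k := j n; set u : R := n%:R.
have u1 : 1 <= u by rewrite ler1n ltnW.
rewrite -EFinB /= -!EFinM; congr EFin.
have -> : ln u ^+ k / (k`!%:R * 2^-1 ^+ k) = 2 ^+ k * lnpow k u.
  rewrite /lnpow exprVn; field.
  by rewrite pnatr_eq0 -lt0n fact_gt0 expf_neq0.
rewrite distrC -mulrBr normrM ger0_norm ?exprn_ge0//.
rewrite ger0_norm ?subr_ge0 ?boxfun_le_lnpow//.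
rewrite /scaled_error exprVn invrK invfM.
have p2 : 2 ^+ k != 0 :> R by rewrite expf_neq0.
have z0 : ln u `^ (k%:R - 2^-1) != 0.
  by rewrite gt_eqF// powR_gt0// ln_gt0// ltr1n.
by field; rewrite p2 z0.
Qed.

Lemma cvg_ln_powN3 : (fun n => cbrtV (ln n%:R)) @ \oo --> (0 : R).
Proof.
apply/cvgrPdist_lt => e e0; near=> n.
have n_gt : expR (e ^- 3) < n%:R by near: n; exact: nbhs_infty_gtr.
have x_gt : e ^- 3 < ln n%:R by rewrite -ltr_expR lnK// posrE (lt_trans _ n_gt)// expR_gt0.
have x0 : 0 < ln n%:R :> R by rewrite (lt_trans _ x_gt)// invr_gt0 exprn_gt0.
rewrite sub0r normrN ger0_norm ?powR_ge0//.
rewrite -(@ltr_pXn2r _ 3) ?nnegrE ?powR_ge0 ?ltW// cbrtV_exp3//.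
by rewrite invf_plt ?posrE// exprn_gt0.
Unshelve. all: by end_near. Qed.

Variable k_ : nat -> nat.
Let y_ n : R := cbrtV (ln n%:R).
Let q_ n : R := y_ n * (k_ n)%:R.

Let y_gt0 n : (1 < n)%N -> 0 < y_ n.
Proof. by move=> n1; rewrite powR_gt0// ln_gt0// ltr1n. Qed.

Let k_gt1 n : (1 < n)%N -> y_ n < q_ n -> (1 < k_ n)%N.
Proof.
move=> n1; rewrite /q_ -{1}[y_ n]mulr1 ltr_pM2l ?y_gt0//.
by rewrite ltr1n.
Qed.

Lemma scaled_error_cvg (a : R) : 0 < a -> q_ n @[n --> \oo] --> a ->
  scaled_error (k_ n) n%:R @[n --> \oo] --> a * Num.sqrt a.
Proof.
move=> a0 qa.
have sqrtqa : Num.sqrt (q_ n) @[n --> \oo] --> Num.sqrt a.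
  by apply: continuous_cvg => //; exact: sqrt_continuous.
have ra : q_ n * Num.sqrt (q_ n) @[n --> \oo] --> a * Num.sqrt a.
  exact: cvgM.
(* The value [a / 2] eventually separates [y_ n], which tends to 0, from [q_ n], which tends to [a];
   this gives [1 < k_ n], as the bounds require. *)
have a20 : 0 < a / 2 by rewrite divr_gt0.
have a2a : a / 2 < a by rewrite ltr_pdivrMr// ltr_pMr// ltr1n.
have ya : \forall n \near \oo, y_ n < a / 2.
  exact: (cvgr_lt 0 cvg_ln_powN3).
have aq : \forall n \near \oo, a / 2 < q_ n by exact: (cvgr_gt a qa).
apply: (@squeeze_cvgr _ _ _ _
  (fun n => q_ n * Num.sqrt (q_ n) * (1 - q_ n ^+ 2 * y_ n))
  (fun n => q_ n * Num.sqrt (q_ n))); last exact: ra.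
- near=> n.
  have n1 : (1 < n)%N by near: n; exact: nbhs_infty_gt.
  apply: scaled_error_bounds; first by rewrite ltr1n.
  apply: k_gt1 => //; apply: (@lt_trans _ _ (a / 2)).
    by near: n; exact: ya.
  by near: n; exact: aq.
- have q2 : q_ n ^+ 2 * y_ n @[n --> \oo] --> (0 : R).
    under eq_fun do rewrite expr2.
    by have := cvgM (cvgM qa qa) cvg_ln_powN3; rewrite mulr0; apply.
  have := cvgM ra (cvgB (cvg_cst (1 : R)) q2).
  by rewrite subr0 mulr1; apply.
Unshelve. all: by end_near. Qed.

(** The condition [k = o((ln n)^(1/2))] eventually makes the relative error [q^2 y] at most 1/2, so
    the lower bound is at least [q^(3/2) / 2], hence at least [q / 2] once [q >= 1]. *)
Lemma scaled_error_cvgy : q_ n @[n --> \oo] --> +oo ->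
  (fun n => (k_ n)%:R : R) =o_\oo (fun n => ln n%:R `^ 2^-1) ->
  (scaled_error (k_ n) n%:R)%:E @[n --> \oo] --> +oo%E.
Proof.
move=> /cvgryPge qy /eqoP ko.
have y_lt1 : \forall n \near \oo, y_ n < 1.
  exact: (cvgr_lt 0 cvg_ln_powN3).
apply/cvgeyPge => A; near=> n.
have n1 : (1 < n)%N by near: n; exact: nbhs_infty_gt.
have x0 : 0 < ln n%:R :> R by rewrite ln_gt0// ltr1n.
have q1 : 1 <= q_ n by near: n; exact: qy.
have q0 : 0 < q_ n by exact: lt_le_trans q1.
have qA : 2 * A <= q_ n by near: n; exact: qy.
have y1 : y_ n < 1 by near: n; exact: y_lt1.
have u1 : 1 < n%:R :> R by rewrite ltr1n.
have /andP[+ _] := scaled_error_bounds u1 (k_gt1 n1 (lt_le_trans y1 q1)).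
rewrite lee_fin; apply: le_trans.
rewrite -/(cbrtV _) -/(y_ n) -/(q_ n).
have s2 : q_ n ^+ 2 * y_ n <= 2^-1.
  have -> : q_ n ^+ 2 * y_ n = (k_ n)%:R ^+ 2 / ln n%:R.
    by rewrite -cbrtV_exp3// -/(y_ n) /q_; ring.
  have : `|(k_ n)%:R : R| <= 2^-1 * `|ln n%:R `^ 2^-1 : R|.
    by near: n; apply: ko.
  rewrite powR12_sqrt ?(ltW x0)// ger0_norm// ger0_norm ?sqrtr_ge0// => kx.
  rewrite ler_pdivrMr//.
  have : (k_ n)%:R ^+ 2 <= (2^-1 * Num.sqrt (ln n%:R)) ^+ 2 :> R.
    by rewrite lerXn2r ?nnegrE ?mulr_ge0 ?sqrtr_ge0.
  rewrite exprMn sqr_sqrtr ?(ltW x0)//; lra.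
have sq1 : 1 <= Num.sqrt (q_ n) by rewrite -sqrtr1 ler_sqrt// ltW.
have : q_ n <= q_ n * Num.sqrt (q_ n) by rewrite ler_pMr.
nra.
Unshelve. all: by end_near. Qed.

End ErrorAsymptotics.

(** * From the growth conditions on [j] to the two limits for [beta21] *)

Lemma equiv_cvg_ratio (R : realType) (a : R) (k : nat -> nat) : 0 < a ->
  (fun n => (k n)%:R : R) ~_\oo (fun n => a * ln n%:R `^ 3^-1) ->
  ln n%:R `^ (- 3^-1) * (k n)%:R @[n --> \oo] --> a.
Proof.
move=> a0 /eqaddoP h; apply/cvgrPdist_le => e e0; near=> n.
have n1 : (1 < n)%N by near: n; exact: nbhs_infty_gt.
have c0 : 0 < ln n%:R `^ 3^-1 :> R by rewrite powR_gt0// ln_gt0// ltr1n.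
(* The tolerance [e / a] compensates the factor [a] in the comparison sequence. *)
have : `|(k n)%:R - a * ln n%:R `^ 3^-1| <= e / a * `|a * ln n%:R `^ 3^-1|.
  by near: n; apply: h; rewrite divr_gt0.
rewrite powRN; set c := _ `^ _ in c0 *.
rewrite [`|a * c|]gtr0_norm ?mulr_gt0// => kc.
rewrite distrC (_ : c^-1 * _ - a = ((k n)%:R - a * c) / c); last first.
  by field; rewrite gt_eqF.
rewrite normrM normfV [`|c|]gtr0_norm// ler_pdivrMr// (le_trans kc)//.
by rewrite mulrA divfK// gt_eqF.
Unshelve. all: by end_near. Qed.

Theorem proposition2p3 (R : realType) :
  exists L : probability R R,
    [/\ L `]0, 1[%classic = 1%E,
        (0 < 'V_L[@ln R])%E,
        ('V_L[@ln R] < +oo)%E,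
        ('E_L[fun x => `|ln (1 - x)|%R] < +oo)%E
      & let mu : R := fine 'E_L[fun x => `|ln x|%R] in
        forall (d0 : measure_display) (T0 : measurableType d0)
          (P0 : probability T0 R) (W : nat -> {RV P0 >-> R})
          (d : measure_display) (T : measurableType d)
          (P : probability T R) (p : seq nat -> nat -> {RV P >-> R}),
        iid_with_law L W ->
        independent_copies P0 (stick_breaking W) p ->
        forall j : nat -> nat, (forall n, (0 < j n)%N) ->
          (forall a : R, 0 < a ->
             (fun n => (j n)%:R : R) ~_\oo (fun n => a * ln n%:R `^ 3^-1) ->
             exists2 l : R, 0 < l &
               normalized_error mu (mean_box_count p) j n @[n --> \oo]
                 --> l%:E) /\
          ((ln n%:R `^ (- 3^-1) * (j n)%:R : R) @[n --> \oo] --> +oo ->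
           (fun n => (j n)%:R : R) =o_\oo (fun n => ln n%:R `^ 2^-1) ->
           normalized_error mu (mean_box_count p) j n @[n --> \oo]
             --> +oo%E)].
Proof.
exists (@beta21 R); split.
- exact: beta21_oo01.
- exact: variance_ln_gt0.
- exact: variance_ln_lty.
- exact: expectation_norm_ln_onem.
rewrite expectation_norm_ln /= => d0 T0 P0 W d T P p iidW copies j _.
have eE : \forall n \near \oo, (scaled_error (j n) n%:R)%:E =
    normalized_error 2^-1 (mean_box_count p) j n.
  near=> n; have n1 : (1 < n)%N by near: n; exact: nbhs_infty_gt.
  rewrite normalized_errorE// (mean_box_countE iidW copies)//.
  by rewrite ler1n ltnW.
split=> [a a0 ja|jy jo].
  (* The limit is [a^(3/2)], the value of [j^(3/2) (log n)^(-1/2)] at [j = a (log n)^(1/3)]. *)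
  exists (a * Num.sqrt a); first by rewrite mulr_gt0// sqrtr_gt0.
  apply: cvg_trans (near_eq_cvg eE) _.
  apply: cvg_EFin; first exact: nearW.
  exact: scaled_error_cvg (equiv_cvg_ratio a0 ja).
apply: cvg_trans (near_eq_cvg eE) _.
exact: scaled_error_cvgy.
Unshelve. all: by end_near. Qed.
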